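(* Let $(R,\mathfrak m)$ be a regular local ring with quotient field $F$ and $\dim R\ge 2$, let $\{(R_i,\mathfrak m_i)\}_{i\ge 0}$ be an infinite sequence of local quadratic transforms with $R_0=R$, and let $S=\bigcup_{i\ge 0}R_i$ with maximal ideal $N=\bigcup_i \mathfrak m_i$. Let $V$ be the boundary valuation ring of $S$ and let $T$ be the Noetherian hull of $S$. Then $S=V\cap T$.
   Context: A local quadratic transform of a regular local ring $(A,\mathfrak n)$ is a local ring $A[\mathfrak n/x]_{\mathfrak q}$ with $x\in\mathfrak n\setminus\mathfrak n^2$ and $\mathfrak q$ a prime ideal of $A[\mathfrak n/x]$ containing $\mathfrak n$. The sequence satisfies: for each $i\ge 0$, $R_{i+1}$ is a local quadratic transform of $R_i$, $R_i\subsetneq R_{i+1}$, and each $R_i$ is a regular local ring of dimension at least $2$ with maximal ideal $\mathfrak m_i$. For each $i$, $\mathrm{ord}_i$ is the order valuation of $R_i$ ($\mathrm{ord}_i(a)=\max\{n: a\in\mathfrak m_i^n\}$ for $0\neq a\in R_i$, extended to $F$ by $\mathrm{ord}_i(a/b)=\mathrm{ord}_i(a)-\mathrm{ord}_i(b)$), with valuation ring $V_i$. Let $\mathfrak X$ be the set of valuation rings $U$ with $R\subseteq U\subseteq F$; the patch topology on $\mathfrak X$ has basic open sets $\{U\in\mathfrak X: G\subseteq U,\ H\subseteq \mathfrak M_U\}$ for finite subsets $G,H\subseteq F$ ($\mathfrak M_U$ the maximal ideal of $U$). A boundary valuation ring of $S$ is a $V\in\mathfrak X$ that is a limit point of $\{V_i: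 i\ge 0\}$ in the patch topology; $S$ has exactly one such $V$. The Noetherian hull $T$ of $S$ is the intersection of all discrete valuation rings with quotient field $F$ that properly contain $S$ (an empty intersection being $F$). *)

(* Defs.v *)
From mathcomp Require Import all_boot all_algebra.
Set Implicit Arguments. Unset Strict Implicit. Unset Printing Implicit Defensive.
Import GRing.Theory.
Local Open Scope ring_scope.

Section Defs.
Variable F : fieldType.
Implicit Types (A B I P U W : F -> Prop) (s : seq F).

Definition ssub (P Q : F -> Prop) : Prop :=
  (forall x, P x -> Q x) /\ exists x, Q x /\ ~ P x.

Definition subring A : Prop :=
  A 1 /\ (forall x y, A x -> A y -> A (x - y)) /\ (forall x y, A x -> A y -> A (x * y)).

Definition ideal A I : Prop :=
  (forall x, I x -> A x) /\ I 0 /\ (forall x y, I x -> I y -> I (x + y)) /\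
  (forall a x, A a -> I x -> I (a * x)).

Definition span A s (z : F) : Prop :=
  exists c : seq F, size c = size s /\ (forall j, (j < size c)%N -> A c`_j) /\
    z = \sum_(j < size s) c`_j * s`_j.

Definition fg_ideal A I : Prop :=
  exists s, (forall j, (j < size s)%N -> I s`_j) /\ forall z, I z <-> span A s z.

Definition noetherian A : Prop := subring A /\ forall I, ideal A I -> fg_ideal A I.

Definition prime_ideal A P : Prop :=
  ideal A P /\ ~ P 1 /\ forall a b, A a -> A b -> P (a * b) -> P a \/ P b.

Definition prime_chain A (n : nat) : Prop :=
  exists P : nat -> F -> Prop, (forall k, (k <= n)%N -> prime_ideal A (P k)) /\
    forall k, (k < n)%N -> ssub (P k) (P k.+1).

Definition krull_dim A (d : nat) : Prop := prime_chain A d /\ ~ prime_chain A d.+1.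

Definition maxideal A (z : F) : Prop := A z /\ (z = 0 \/ ~ A z^-1).

(* local ring: the non-units form an ideal (which is then the unique maximal ideal) *)
Definition local A : Prop := subring A /\ ideal A (maxideal A).

Definition regular_local A (d : nat) : Prop :=
  noetherian A /\ local A /\ krull_dim A d /\
  exists s, size s = d /\ (forall j, (j < size s)%N -> maxideal A s`_j) /\
    forall z, maxideal A z <-> span A s z.

Fixpoint idpow A I (n : nat) : F -> Prop :=
  match n with
  | 0 => A
  | n'.+1 => fun z => exists ps : seq (F * F),
      (forall j, (j < size ps)%N -> I (nth (0, 0) ps j).1 /\ idpow A I n' (nth (0, 0) ps j).2) /\
      z = \sum_(j < size ps) (nth (0, 0) ps j).1 * (nth (0, 0) ps j).2
  end.

Definition adjoin A (G : F -> Prop) (z : F) : Prop :=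
  forall B, subring B -> (forall a, A a -> B a) -> (forall g, G g -> B g) -> B z.

Definition quadratic_transform A A' : Prop :=
  exists x, maxideal A x /\ ~ idpow A (maxideal A) 2 x /\
    let B := adjoin A (fun z => exists y, maxideal A y /\ z = y / x) in
    exists q, prime_ideal B q /\ (forall y, maxideal A y -> q y) /\
      forall z, A' z <-> exists b c, B b /\ B c /\ ~ q c /\ z = b / c.

Definition quotient_field A : Prop :=
  forall z, exists a b, A a /\ A b /\ b != 0 /\ z = a / b.

(* ord_A(a) >= ord_A(b), written relationally: every power of m containing b contains a *)
Definition ord_ge A (a b : F) : Prop :=
  forall n, idpow A (maxideal A) n b -> idpow A (maxideal A) n a.

Definition ord_valring A (z : F) : Prop :=
  z = 0 \/ exists a b, A a /\ A b /\ b != 0 /\ z = a / b /\ ord_ge A a b.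

Definition valuation_ring U : Prop := subring U /\ forall z, z != 0 -> U z \/ U z^-1.

Definition valmax U (z : F) : Prop := U z /\ (z = 0 \/ ~ U z^-1).

(* V is a boundary valuation ring of S = U R_i: V is a valuation ring containing
   R_0 and a limit point of {V_i} in the patch topology *)
Definition boundary_valuation_ring (R : nat -> F -> Prop) U : Prop :=
  valuation_ring U /\ (forall z, R 0%N z -> U z) /\
  forall G H : seq F, (forall g, g \in G -> U g) -> (forall h, h \in H -> valmax U h) ->
    exists i, (exists z, ~ (ord_valring (R i) z <-> U z)) /\
      (forall g, g \in G -> ord_valring (R i) g) /\
      (forall h, h \in H -> valmax (ord_valring (R i)) h).

Definition dvr W : Prop := valuation_ring W /\ noetherian W /\ exists z, ~ W z.

Definition noetherian_hull (S : F -> Prop) (z : F) : Prop :=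
  forall W, dvr W -> ssub S W -> W z.

End Defs.

(* Main.v *)
(** For a in R_i let ord_i(a) be its order and V_i the order valuation ring; write m_i R_{i+1} =
    t_i R_{i+1}.  Counting lengths, with Artin-Rees in the form of a standard-basis argument, a
    regular system of parameters is analytically independent, so every nonzero element of a regular
    local ring has a unique leading monomial and leading monomials are additive.  Hence ord_i is a
    valuation and R_i is normal, so each localization of R_i is an intersection of discrete
    valuation rings.  As S[1/t_i] is such a localization and 1/t_i is not in S, the Noetherian
    hull T is contained in S[1/t_i] for every i.

    Now let z = a/b be in V and in T.  Dividing a and b by t_i^r, with r the smaller of their
    orders, never increases r, because the order of a strict transform does not exceed the original
    order (Taylor expansion at the generic point of the center).  Where r is minimal, z in V_i
    implies z in V_h for all h >= i, and z is in V_i for arbitrarily large i since V is a limit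
    point.  Finally z is in R_j[1/t_i] for some j, and since t_h generates a prime ideal of R_{h+1}
    with localization V_h, the conditions z in V_h remove the denominators t_i, ..., t_{j-1} one
    after the other. *)
Require Import Defs.
From mathcomp Require Import all_boot all_order all_algebra.
From mathcomp Require Import ring zify.
From mathcomp.multinomials Require Import mpoly.
From Stdlib Require Import Classical ClassicalEpsilon.
Set Implicit Arguments. Unset Strict Implicit. Unset Printing Implicit Defensive.
Import Order.TTheory GRing.Theory.
Local Open Scope ring_scope.

(** * Subrings, ideals and local rings *)

(** All rings are predicates on the one field [F], and the arguments stay inside it. Ideals [P + I]
    of [A] stand for ideals of [A / P], lists in which no entry is generated by the later ones stand
    for lower bounds on lengths, and monomials in generators of the maximal ideal m, compared first
    by degree, stand for the associated graded ring. The leading monomial is the smallest one, so a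
    reduction need not terminate; each reduction is run only up to a power m^N and closed by the
    Krull intersection theorem. The dimension is given by chains of primes, and the only thing
    extracted from it is that no monomial in the parameters is a combination of larger ones: a chain
    with d inclusions forces n^d independent elements modulo m^(C n), which is too many if the
    multiples of one monomial are redundant. From then on regularity is used in this form alone. The
    union S need not be Noetherian. Discrete valuation rings above it are therefore constructed over
    the Noetherian normal rings R_i, by inverting those elements of R_i that divide a power of t_i
    in some later ring. *)

Section Subrings.
Variable F : fieldType.
Implicit Types (A I J P Q : F -> Prop) (x y z a b c : F).

Section Closure.
Variables (A : F -> Prop) (sA : subring A).

Lemma subring1 : A 1. Proof. by case: sA. Qed.
Lemma subringB x y : A x -> A y -> A (x - y). Proof. by case: sA => _ [+ _]; apply. Qed.
Lemma subringM x y : A x -> A y -> A (x * y). Proof. by case: sA => _ [_]; apply. Qed.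
Lemma subring0 : A 0. Proof. by rewrite -(subrr 1); apply: subringB; apply: subring1. Qed.
Lemma subringN x : A x -> A (- x).
Proof. by move=> Ax; rewrite -sub0r; apply: subringB => //; apply: subring0. Qed.
Lemma subringD x y : A x -> A y -> A (x + y).
Proof. by move=> Ax Ay; rewrite -[y]opprK; apply: subringB => //; apply: subringN. Qed.
Lemma subringX x n : A x -> A (x ^+ n).
Proof.
move=> Ax; elim: n => [|n IH]; first by rewrite expr0; apply: subring1.
by rewrite exprS; apply: subringM.
Qed.
Lemma subring_sum (T : Type) (r : seq T) (p : pred T) (f : T -> F) :
  (forall i, p i -> A (f i)) -> A (\sum_(i <- r | p i) f i).
Proof. by move=> H; apply: big_ind => //; [apply: subring0 | apply: subringD]. Qed.
Lemma subring_prod (T : Type) (r : seq T) (p : pred T) (f : T -> F) :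
  (forall i, p i -> A (f i)) -> A (\prod_(i <- r | p i) f i).
Proof. by move=> H; apply: big_ind => //; [apply: subring1 | apply: subringM]. Qed.
End Closure.

Section Ideals.
Variables (A I : F -> Prop) (iI : ideal A I).

Lemma idealS x : I x -> A x. Proof. by case: iI => + _; apply. Qed.
Lemma ideal0 : I 0. Proof. by case: iI => _ []. Qed.
Lemma idealD x y : I x -> I y -> I (x + y). Proof. by case: iI => _ [_ [+ _]]; apply. Qed.
Lemma idealM a x : A a -> I x -> I (a * x). Proof. by case: iI => _ [_ [_]]; apply. Qed.
Lemma ideal_sum (T : Type) (r : seq T) (p : pred T) (f : T -> F) :
  (forall i, p i -> I (f i)) -> I (\sum_(i <- r | p i) f i).
Proof. by move=> H; apply: big_ind => //; [apply: ideal0 | apply: idealD]. Qed.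
Hypothesis sA : subring A.
Lemma idealN x : I x -> I (- x).
Proof. by move=> Ix; rewrite -mulN1r; apply: idealM => //; apply/(subringN sA)/(subring1 sA). Qed.
Lemma idealB x y : I x -> I y -> I (x - y).
Proof. by move=> Ix Iy; apply: idealD => //; apply: idealN. Qed.
End Ideals.

Definition idsum I J z := exists a b, I a /\ J b /\ z = a + b.
Definition mult I a z := exists b, I b /\ z = a * b.

Lemma idsum_ideal A I J : subring A -> ideal A I -> ideal A J -> ideal A (idsum I J).
Proof.
move=> sA iI iJ; split=> [z [a [b [Ia [Jb ->]]]]|].
  by apply: (subringD sA); [apply: (idealS iI) | apply: (idealS iJ)].
split; first by exists 0, 0; rewrite addr0; split; [apply: ideal0 iI | split=> //; apply: ideal0 iJ].
split=> [x y [a [b [Ia [Jb ->]]]] [a' [b' [Ia' [Jb' ->]]]] | c x Ac [a [b [Ia [Jb ->]]]]].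
  by exists (a + a'), (b + b'); rewrite addrACA; split; [apply: (idealD iI) | split=> //; apply: (idealD iJ)].
by exists (c * a), (c * b); rewrite mulrDr; split; [apply: (idealM iI) | split=> //; apply: (idealM iJ)].
Qed.

Lemma mult_ideal A I a : subring A -> ideal A I -> A a -> ideal A (mult I a).
Proof.
move=> sA iI Aa; split=> [z [b [Ib ->]]|]; first by apply: (subringM sA) => //; apply: (idealS iI).
split; first by exists 0; rewrite mulr0; split=> //; apply: ideal0 iI.
split=> [x y [b [Ib ->]] [b' [Ib' ->]] | c x Ac [b [Ib ->]]].
  by exists (b + b'); rewrite mulrDr; split=> //; apply: (idealD iI).
by exists (c * b); rewrite mulrCA; split=> //; apply: (idealM iI).
Qed.

Lemma ideal_self A : subring A -> ideal A A.
Proof.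
move=> sA; split=> //; split; first exact: subring0.
by split=> *; [apply: subringD | apply: subringM].
Qed.

Lemma ideal_zero A : subring A -> ideal A (fun z => z = 0).
Proof.
move=> sA; split=> [x ->|]; first exact: subring0.
by split=> //; split=> [x y -> -> | a x _ ->]; rewrite ?addr0 ?mulr0.
Qed.

Lemma idsumL A I J : ideal A J -> forall z, I z -> idsum I J z.
Proof. by move=> iJ z Iz; exists z, 0; rewrite addr0; split=> //; split=> //; apply: ideal0 iJ. Qed.

Lemma idsumR A I J : ideal A I -> forall z, J z -> idsum I J z.
Proof. by move=> iI z Jz; exists 0, z; rewrite add0r; split=> //; apply: ideal0 iI. Qed.

Lemma ideal_chain_union A (C : nat -> F -> Prop) :
  (forall n, ideal A (C n)) -> (forall n x, C n x -> C n.+1 x) ->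
  ideal A (fun z => exists n, C n z).
Proof.
move=> iC CS; have Cle n k x : C n x -> C (k + n)%N x by elim: k => // k IH /IH /CS.
split=> [x [n /(idealS (iC n))] //|]; split; first by exists 0%N; apply: ideal0 (iC 0%N).
split=> [x y [n Cx] [k Cy] | a x Aa [n Cx]].
  exists (k + n)%N; apply: (idealD (iC _)); first exact: Cle.
  by rewrite addnC; apply: Cle.
by exists n; apply: (idealM (iC n)).
Qed.

Lemma noetherian_acc A (C : nat -> F -> Prop) : noetherian A ->
  (forall n, ideal A (C n)) -> (forall n x, C n x -> C n.+1 x) ->
  exists n, forall k x, C k x -> C n x.
Proof.
move=> [sA nA] iC CS; have Cle n k x : C n x -> C (k + n)%N x by elim: k => // k IH /IH /CS.
have [s [sI sP]] := nA _ (ideal_chain_union iC CS).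
have [n nP] : exists n, forall j, (j < size s)%N -> C n s`_j.
  elim: s sI {sP} => [|a s IH] sI; first by exists 0%N.
  have [j | n nP] := IH; first by move=> js; apply: (sI j.+1).
  have [k /= kP] := sI 0%N isT.
  exists (n + k)%N => -[|j] js /=; first exact: Cle.
  by rewrite addnC; apply: Cle; apply: nP.
exists n => k x Cx; have /sP [c [sc [Ac ->]]] : exists n, C n x by exists k.
apply: (ideal_sum (iC n)) => j _; apply: (idealM (iC n)); last exact: nP.
by apply: Ac; rewrite sc.
Qed.

Lemma noetherian_maximal A (C : (F -> Prop) -> Prop) I0 : noetherian A ->
  C I0 -> (forall I, C I -> ideal A I) ->
  exists I, C I /\ forall J, C J -> (forall x, I x -> J x) -> forall x, J x -> I x.
Proof.
move=> nA CI0 iC; apply: NNPP => nomax.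
have step (I : {I | C I}) : {J : {I | C I} | ssub (sval I) (sval J)}.
  apply: constructive_indefinite_description; apply: NNPP => nJ; apply: nomax.
  exists (sval I); split; first exact: (svalP I).
  move=> J CJ IJ x Jx; apply: NNPP => nIx; apply: nJ.
  by exists (exist _ J CJ); split=> //=; exists x.
pose ch n := iter n (fun I : {I | C I} => sval (step I)) (exist _ I0 CI0).
have chS n : ssub (sval (ch n)) (sval (ch n.+1)) by apply: (svalP (step (ch n))).
have [|n x|n nP] := @noetherian_acc A (fun n => sval (ch n)) nA.
- by move=> n; apply: iC; apply: (svalP (ch n)).
- by case: (chS n) => + _; apply.
- by case: (chS n) => _ [x [xS []]]; apply: nP xS.
Qed.

Definition isunit A u := u != 0 /\ A u /\ A u^-1.

Lemma unit1 A : subring A -> isunit A 1.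
Proof. by move=> sA; rewrite /isunit oner_eq0 invr1; do !split=> //; apply: subring1. Qed.

Lemma unitM A u v : subring A -> isunit A u -> isunit A v -> isunit A (u * v).
Proof.
move=> sA [u0 [Au iu]] [v0 [Av iv]]; rewrite /isunit mulf_neq0 // invfM.
by do !split=> //; apply: (subringM sA).
Qed.

Lemma unitV A u : isunit A u -> isunit A u^-1.
Proof. by move=> [u0 [Au iu]]; rewrite /isunit invr_eq0 invrK. Qed.

Section Local.
Variables (A : F -> Prop) (lA : local A).
Let sA : subring A. Proof. by case: lA. Qed.
Let iM : ideal A (maxideal A). Proof. by case: lA. Qed.

Lemma unit_or_max z : A z -> isunit A z \/ maxideal A z.
Proof.
move=> Az; have [->|nz] := eqVneq z 0; first by right; apply: ideal0 iM.
by case: (classic (A z^-1)) => [h|h]; [left | right; split=> //; right].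
Qed.

Lemma unit_not_max u : isunit A u -> ~ maxideal A u.
Proof. by move=> [u0 [Au Aiu]] [_ [/eqP|//]]; rewrite (negPf u0). Qed.

Lemma max1 : ~ maxideal A 1. Proof. exact/unit_not_max/(unit1 sA). Qed.

Lemma unit_sub1 z : maxideal A z -> isunit A (1 - z).
Proof.
move=> mz; have [//|m1] : isunit A (1 - z) \/ maxideal A (1 - z).
  by apply: unit_or_max; apply: (subringB sA); [apply: subring1 | case: mz].
by case: max1; rewrite -(subrK z 1); apply: (idealD iM).
Qed.

Lemma proper_ideal_max I : ideal A I -> ~ I 1 -> forall z, I z -> maxideal A z.
Proof.
move=> iI nI1 z Iz; have [[z0 [Az iz]]|//] := unit_or_max (idealS iI Iz).
by case: nI1; rewrite -(mulVf z0); apply: (idealM iI).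
Qed.

Lemma maxideal_prime : prime_ideal A (maxideal A).
Proof.
split=> //; split; first exact: max1.
move=> a b Aa Ab mab.
have [ua|] := unit_or_max Aa; last by left.
have [ub|] := unit_or_max Ab; last by right.
by case: (unit_not_max (unitM sA ua ub)).
Qed.

End Local.
End Subrings.

(** * Spans of monomials and the Krull intersection theorem *)

Section IdealPowers.
Variables (F : fieldType) (A I : F -> Prop).
Hypotheses (sA : subring A) (iI : ideal A I).

Lemma idpowSP n z : idpow A I n.+1 z <->
  exists ps : seq (F * F), (forall p, p \in ps -> I p.1 /\ idpow A I n p.2) /\
    z = \sum_(p <- ps) p.1 * p.2.
Proof.
split=> -[ps [psP ->]]; exists ps; split; rewrite ?(big_nth (0, 0)) ?big_mkord //.
  by move=> p pps; rewrite -(nth_index (0, 0) pps); apply: psP; rewrite index_mem.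
by move=> j js; apply: psP; apply: mem_nth.
Qed.

Lemma idpow_ideal n : ideal A (idpow A I n).
Proof.
elim: n => [|n IH]; first exact: ideal_self.
split=> [z /idpowSP [ps [psP ->]]|].
  rewrite big_seq; apply: (subring_sum sA) => p /psP [Ip /(idealS IH) Ap].
  by apply: (subringM sA) => //; apply: (idealS iI).
split; first by apply/idpowSP; exists [::]; rewrite big_nil.
split=> [x y /idpowSP [ps [psP ->]] /idpowSP [qs [qsP ->]] | a x Aa /idpowSP [ps [psP ->]]].
  apply/idpowSP; exists (ps ++ qs); rewrite big_cat; split=> // p.
  by rewrite mem_cat => /orP [/psP|/qsP].
apply/idpowSP; exists [seq (p.1, a * p.2) | p <- ps]; split=> [p /mapP [q /psP [? ?] ->] /=|].
  by split=> //; apply: (idealM IH).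
by rewrite big_map mulr_sumr; apply: eq_bigr => p _; rewrite mulrCA.
Qed.

Lemma idpowM n a b : I a -> idpow A I n b -> idpow A I n.+1 (a * b).
Proof.
move=> Ia Ib; apply/idpowSP; exists [:: (a, b)]; rewrite big_seq1; split=> // p.
by rewrite mem_seq1 => /eqP ->.
Qed.

End IdealPowers.

Section MonomialSpans.
Variables (F : fieldType) (A : F -> Prop) (d : nat) (x : 'I_d -> F).
Implicit Types (Q : 'X_{1..d} -> Prop) (b m : 'X_{1..d}) (z : F) (p q : {mpoly F[d]}).

Definition coefs_in p := forall m, A p@_m.

(** The polynomials have coefficients in [F] because [A] is a predicate and not a ring type;
    [coefs_in] keeps them in [A]. Powers of the maximal ideal and the steps of the filtration by
    monomials are both instances, for different [Q]. *)
Definition monspan Q z :=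
  exists p, coefs_in p /\ (forall m, p@_m != 0 -> Q m) /\ z = p.@[x].

Definition mon b : F := ('X_[b] : {mpoly F[d]}).@[x].

Lemma mon0 : mon 0%MM = 1. Proof. by rewrite /mon mpolyX0 meval1. Qed.
Lemma monD b b' : mon (b + b')%MM = mon b * mon b'.
Proof. by rewrite /mon mpolyXD mevalM. Qed.
Lemma mon1 i : mon U_(i)%MM = x i. Proof. exact: mevalXU. Qed.
Lemma monE b : mon b = \prod_i x i ^+ b i. Proof. exact: mevalX. Qed.

Lemma mevalE_mon p : p.@[x] = \sum_(m <- msupp p) p@_m * mon m.
Proof. by rewrite mevalE; apply: eq_bigr => m _; rewrite monE. Qed.

Lemma monspanS Q Q' z : (forall m, Q m -> Q' m) -> monspan Q z -> monspan Q' z.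
Proof. by move=> QQ' [p [Ap [pQ ->]]]; exists p; split=> //; split=> // m /pQ /QQ'. Qed.

Hypotheses (sA : subring A).

Lemma coefs_inM p q : coefs_in p -> coefs_in q -> coefs_in (p * q).
Proof.
by move=> Ap Aq m; rewrite mcoeffM; apply: (subring_sum sA) => k _; apply: (subringM sA).
Qed.
Lemma coefs_inD p q : coefs_in p -> coefs_in q -> coefs_in (p + q).
Proof. by move=> Ap Aq m; rewrite mcoeffD; apply: (subringD sA). Qed.
Lemma coefs_inB p q : coefs_in p -> coefs_in q -> coefs_in (p - q).
Proof. by move=> Ap Aq m; rewrite mcoeffB; apply: (subringB sA). Qed.
Lemma coefs_inZ c p : A c -> coefs_in p -> coefs_in (c *: p).
Proof. by move=> Ac Ap m; rewrite mcoeffZ; apply: (subringM sA). Qed.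
Lemma coefs_inX m : coefs_in 'X_[m].
Proof. by move=> k; rewrite mcoeffX; case: eqP => _; [apply: subring1 | apply: subring0]. Qed.
Lemma coefs_inC c : A c -> coefs_in c%:MP.
Proof.
move=> Ac k; rewrite mcoeffC; case: eqP => _; rewrite ?mulr1 ?mulr0 //; exact: subring0.
Qed.
Lemma coefs_in_exp p n : coefs_in p -> coefs_in (p ^+ n).
Proof.
move=> Ap; elim: n => [|n IH]; first by rewrite expr0; apply: coefs_inC; apply: subring1.
by rewrite exprS; apply: coefs_inM.
Qed.
Lemma coefs_in_sum (T : Type) (r : seq T) (P : pred T) (f : T -> {mpoly F[d]}) :
  (forall i, P i -> coefs_in (f i)) -> coefs_in (\sum_(i <- r | P i) f i).
Proof.
move=> H; apply: big_ind => //; last exact: coefs_inD.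
by move=> m; rewrite mcoeff0; apply: subring0.
Qed.
Lemma coefs_in_prod (T : Type) (r : seq T) (P : pred T) (f : T -> {mpoly F[d]}) :
  (forall i, P i -> coefs_in (f i)) -> coefs_in (\prod_(i <- r | P i) f i).
Proof.
move=> H; apply: big_ind => //; last exact: coefs_inM.
by apply: coefs_inC; apply: subring1.
Qed.

Lemma monspan_mon Q c b : A c -> Q b -> monspan Q (c * mon b).
Proof.
move=> Ac Qb; exists (c *: 'X_[b]); split; first by apply: coefs_inZ => //; apply: coefs_inX.
split; last by rewrite mevalZ.
by move=> m; rewrite mcoeffZ mcoeffX; have [<-//|_] := eqVneq b m; rewrite mulr0 eqxx.
Qed.

Lemma monspan_mon1 Q b : Q b -> monspan Q (mon b).
Proof. by move=> Qb; rewrite -[mon b]mul1r; apply: monspan_mon => //; apply: subring1. Qed.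

Lemma monspanD Q z z' : monspan Q z -> monspan Q z' -> monspan Q (z + z').
Proof.
move=> [p [Ap [pQ ->]]] [q [Aq [qQ ->]]]; exists (p + q); rewrite mevalD.
split; first exact: coefs_inD.
split=> // m; rewrite mcoeffD; have [->|/pQ//] := eqVneq (p@_m) 0.
by rewrite add0r => /qQ.
Qed.

Lemma monspanM Q Q' Q'' z z' : (forall m m', Q m -> Q' m' -> Q'' (m + m')%MM) ->
  monspan Q z -> monspan Q' z' -> monspan Q'' (z * z').
Proof.
move=> QQ [p [Ap [pQ ->]]] [q [Aq [qQ ->]]]; exists (p * q); rewrite mevalM.
split; first exact: coefs_inM.
split=> // m; rewrite -mcoeff_msupp => /msuppM_le /allpairsP [[k l] /= [pk ql ->]].
by apply: QQ; [apply: pQ | apply: qQ]; rewrite -mcoeff_msupp.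
Qed.

Hypothesis Ax : forall i, A (x i).

Lemma mon_in b : A (mon b).
Proof. by rewrite monE; apply: (subring_prod sA) => i _; apply: (subringX sA). Qed.

Lemma meval_in p : coefs_in p -> A p.@[x].
Proof.
move=> Ap; rewrite mevalE_mon; apply: (subring_sum sA) => m _.
by apply: (subringM sA) => //; apply: mon_in.
Qed.

Lemma monspan_ideal Q : ideal A (monspan Q).
Proof.
split=> [z [p [Ap [_ ->]]]|]; first exact: meval_in.
split; first by exists 0; rewrite meval0; split=> [m|]; [|split=> // m];
  rewrite mcoeff0 ?eqxx //; apply: subring0.
split=> [z z'|a z Aa]; first exact: monspanD.
move=> [p [Ap [pQ ->]]]; exists (a *: p); rewrite mevalZ; split; first exact: coefs_inZ.
split=> // m; rewrite mcoeffZ => nz; apply: pQ; apply: contraNneq nz => ->.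
by rewrite mulr0.
Qed.

Lemma monspan_sub Q J z : ideal A J -> (forall b, Q b -> J (mon b)) -> monspan Q z -> J z.
Proof.
move=> iJ QJ [p [Ap [pQ ->]]]; rewrite mevalE_mon big_seq; apply: (ideal_sum iJ) => m.
by rewrite mcoeff_msupp => /pQ /QJ Jm; apply: (idealM iJ).
Qed.

End MonomialSpans.

Definition generates (F : fieldType) (A : F -> Prop) d (x : 'I_d -> F) :=
  forall z, maxideal A z <-> exists c : 'I_d -> F, (forall i, A (c i)) /\ z = \sum_i c i * x i.

(** The power of the maximal ideal without recursion ([idpowP]): products and inclusions become
    statements about exponents. *)
Definition mpow (F : fieldType) (A : F -> Prop) d (x : 'I_d -> F) n :=
  monspan A x (fun b => (n <= mdeg b)%N).

Lemma mdeg_pos_split d (b : 'X_{1..d}) : (0 < mdeg b)%N ->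
  exists i b', b = (U_(i) + b')%MM.
Proof.
rewrite lt0n mdeg_eq0 => nz; have [i bi] : exists i, b i != 0%N.
  apply/existsP; apply: contraNT nz; rewrite negb_exists => /forallP h.
  by apply/eqP/mnmP => i; rewrite mnm0E; apply/eqP; move: (h i); rewrite negbK.
by exists i, (b - U_(i))%MM; rewrite addmC submK // lep1mP.
Qed.

Section MaxPowers.
Variables (F : fieldType) (A : F -> Prop) (d : nat) (x : 'I_d -> F).
Hypotheses (lA : local A) (gx : generates A x).
Let sA : subring A. Proof. by case: lA. Qed.
Let iM : ideal A (maxideal A). Proof. by case: lA. Qed.

Lemma generators_max i : maxideal A (x i).
Proof.
apply/gx; exists (fun j => (j == i)%:R); split=> [j|].
  by case: eqP => _; [apply: subring1 | apply: subring0].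
by rewrite (bigD1 i) //= eqxx mul1r big1 ?addr0 // => j /negPf ->; rewrite mul0r.
Qed.

Lemma generators_in i : A (x i). Proof. by case: (generators_max i). Qed.
Let Ax := generators_in.

Lemma mpow_ideal n : ideal A (mpow A x n). Proof. exact: monspan_ideal. Qed.

Lemma mpow0 z : A z -> mpow A x 0 z.
Proof. by move=> Az; rewrite -[z]mulr1 -(mon0 x); apply: monspan_mon. Qed.

Lemma mpow1 z : mpow A x 1 z <-> maxideal A z.
Proof.
split=> [|/gx [c [Ac ->]]].
  apply: monspan_sub => // b /mdeg_pos_split [i [b' ->]]; rewrite monD mon1 mulrC.
  by apply: (idealM iM); [apply: mon_in | apply: generators_max].
apply: (ideal_sum (mpow_ideal 1)) => i _; rewrite -(mon1 x).
by apply: monspan_mon => //; rewrite mdeg1.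
Qed.

Lemma mpowM n k z w : mpow A x n z -> mpow A x k w -> mpow A x (n + k) (z * w).
Proof. by apply: monspanM => // m m' h h'; rewrite mdegD leq_add. Qed.

Lemma mpow_le n k z : (n <= k)%N -> mpow A x k z -> mpow A x n z.
Proof. by move=> nk; apply: monspanS => m; apply: leq_trans. Qed.

Lemma idpowP n z : idpow A (maxideal A) n z <-> mpow A x n z.
Proof.
split.
  elim: n z => [|n IH] z; first exact: mpow0.
  move/idpowSP => [ps [psP ->]]; rewrite big_seq; apply: (ideal_sum (mpow_ideal _)) => p.
  by case/psP => /mpow1 h /IH h'; rewrite -add1n; apply: mpowM.
apply: monspan_sub => //; first exact: idpow_ideal.
elim: n => [|n IH] b bn; first exact: mon_in.
have [|i [b' bE]] := @mdeg_pos_split _ b; first exact: leq_trans bn.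
rewrite bE monD mon1; apply: idpowM; first exact: generators_max.
by apply: IH; move: bn; rewrite bE mdegD mdeg1.
Qed.

Hypothesis nA : noetherian A.

(** Pigeonhole: a monomial of degree above [d * n] has some exponent at least [n]. *)
Lemma mpow_sub_of_generators J n : ideal A J -> (forall i, J (x i ^+ n)) ->
  exists N, forall z, mpow A x N z -> J z.
Proof.
move=> iJ Jx; exists (d * n).+1 => z; apply: monspan_sub => // b bn.
have [i bi] : exists i, (n <= b i)%N.
  apply/existsP; apply: contraLR bn; rewrite negb_exists -leqNgt => /forallP h.
  rewrite mdegE -[d in (_ <= d * _)%N]card_ord -sum_nat_const.
  by apply: leq_sum => i _; apply: ltnW; rewrite ltnNge; apply: h.
rewrite monE (bigD1 i) //= -(subnK bi) exprD mulrAC.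
apply: (idealM iJ) => //; apply: (subringM sA); first exact: (subringX sA).
by apply: (subring_prod sA) => j _; apply: (subringX sA).
Qed.

(* With D the intersection of all J + m^N, choose K maximal with J <= K < D, so that m D <= K,
   and then K' maximal with K' /\ D = K: stabilisation of the colon ideals (K' : t^n) puts a
   power of every t in m into K'. *)
Lemma krull_intersection J z : ideal A J ->
  (forall N, idsum J (mpow A x N) z) -> J z.
Proof.
move=> iJ; set D := fun z => forall N, idsum J (mpow A x N) z.
have iJm N : ideal A (idsum J (mpow A x N)) by apply: idsum_ideal => //; apply: mpow_ideal.
have iD : ideal A D.
  split=> [y /(_ 0%N) /(idealS (iJm _)) //|].
  split=> [N|]; first exact: ideal0 (iJm N).
  split=> [y y' Dy Dy' N | a y Aa Dy N]; first exact: (idealD (iJm N)).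
  exact: (idealM (iJm N)).
have JD y : J y -> D y by move=> Jy N; apply: (idsumL (mpow_ideal N)).
move=> Dz; apply: NNPP => nJz.
pose C1 K := ideal A K /\ (forall y, J y -> K y) /\ ssub K D.
have [|K [CK]] := @noetherian_maximal _ A C1 J nA _ (fun K h => proj1 h).
  by split=> //; split=> //; split=> //; exists z.
case: (CK) => iK [JK [KD [e [De nKe]]]] Kmax.
have DK y : D y -> ~ K y -> forall w, D w -> idsum K (mult A y) w.
  move=> Dy nKy w Dw; apply: NNPP => nw.
  have Ay : A y by apply: (idealS iD).
  have iS : ideal A (idsum K (mult A y)).
    by apply: idsum_ideal => //; apply: mult_ideal => //; apply: ideal_self.
  apply: nKy; apply: (Kmax (idsum K (mult A y))); last 1 first.
  - exists 0, y; rewrite add0r; split; first exact: ideal0 iK.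
    by split=> //; exists 1; rewrite mulr1; split=> //; apply: subring1.
  - split=> //; split; first by move=> u /JK Ku; apply: (idsumL (mult_ideal sA (ideal_self sA) Ay)).
    split=> [u [k [_ [/KD Dk [[c [Ac ->]] ->]]]]|]; last by exists w.
    by apply: (idealD iD) => //; rewrite mulrC; apply: (idealM iD).
  - by move=> u Ku; apply: (idsumL (mult_ideal sA (ideal_self sA) Ay)).
have mDK t y : maxideal A t -> D y -> K (t * y).
  move=> mt Dy; apply: NNPP => nK.
  have At : A t by case: mt.
  have nKy : ~ K y by move=> Ky; apply: nK; apply: (idealM iK).
  have [k [_ [Kk [[c [Ac ->]] yE]]]] := DK _ (idealM iD At Dy) nK y Dy.
  have [n0 [_ Ai]] : isunit A (1 - c * t) by apply: unit_sub1 => //; apply: (idealM iM).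
  apply: nKy; have -> : y = (1 - c * t)^-1 * k.
    apply: (mulfI n0); rewrite mulVKf // mulrBl mul1r {1}yE; ring.
  exact: (idealM iK).
pose C2 L := ideal A L /\ (forall y, K y -> L y) /\ (forall y, L y -> D y -> K y).
have [|L [CL Lmax]] := @noetherian_maximal _ A C2 K nA _ (fun K h => proj1 h).
  by split.
case: (CL) => iL [KL LDK].
have Lpow t : maxideal A t -> exists n, L (t ^+ n).
  move=> mt; have At : A t by case: mt.
  pose Col n y := A y /\ L (t ^+ n * y).
  have iCol n : ideal A (Col n).
    split=> [y []//|]; split; first by split; [apply: subring0 | rewrite mulr0; apply: ideal0 iL].
    split=> [u v [Au Lu] [Av Lv] | a u Aa [Au Lu]].
      by split; [apply: (subringD sA) | rewrite mulrDr; apply: (idealD iL)].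
    by split; [apply: (subringM sA) | rewrite mulrCA; apply: (idealM iL)].
  have [|n nP] := noetherian_acc nA iCol.
    by move=> n y [Ay Ly]; split=> //; rewrite exprS -mulrA; apply: (idealM iL).
  exists n; have Atn := subringX sA n At.
  have iS : ideal A (idsum L (mult A (t ^+ n))).
    by apply: idsum_ideal => //; apply: mult_ideal => //; apply: ideal_self.
  apply: (Lmax (idsum L (mult A (t ^+ n)))); last 1 first.
  - exists 0, (t ^+ n); rewrite add0r; split; first exact: ideal0 iL.
    by split=> //; exists 1; rewrite mulr1; split=> //; apply: subring1.
  - split=> //; split; first by move=> u /KL Lu; apply: (idsumL (mult_ideal sA (ideal_self sA) Atn)).
    move=> u [l [_ [Ll [[v [Av ->]] ->]]]] Du; apply: LDK => //; apply: (idealD iL) => //.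
    suff [//] : Col n v; apply: (nP n.+1); split=> //.
    have -> : t ^+ n.+1 * v = t * (l + t ^+ n * v) - t * l by rewrite exprS; ring.
    by apply: (idealB iL sA); [apply: KL; apply: mDK | apply: (idealM iL)].
  - by move=> u Lu; apply: (idsumL (mult_ideal sA (ideal_self sA) Atn)).
have [n Ln] : exists n, forall i, L (x i ^+ n).
  pose f i := proj1_sig (constructive_indefinite_description _ (Lpow _ (generators_max i))).
  exists (\max_i f i)%N => i; rewrite -(subnK (leq_bigmax i)) exprD.
  apply: (idealM iL); first exact: (subringX sA).
  exact: (proj2_sig (constructive_indefinite_description _ (Lpow _ (generators_max i)))).
have [N LN] := mpow_sub_of_generators iL Ln.
apply: nKe; apply: LDK => //; have [u [v [Ju [/LN Lv ->]]]] := De N.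
by apply: (idealD iL) => //; apply: KL; apply: JK.
Qed.

End MaxPowers.

(** * Leading monomials, Dickson's lemma and Artin-Rees *)

(** Classical truth value, so that [arg_maxP] and [ex_minnP] apply to arbitrary propositions. *)
Definition asbool (P : Prop) : bool := if excluded_middle_informative P then true else false.

Lemma asboolP P : reflect P (asbool P).
Proof. by rewrite /asbool; case: excluded_middle_informative => h; constructor. Qed.

(** Dickson's lemma with a bound in place of a finite set of minimal elements. In the induction,
    [v0] bounds the last coordinate needed for each of the finitely many patterns of the first [k]
    coordinates below [c0]. This settles every [f] with [v0 <= f k]; the others lie in [v0] slices,
    each covered by the induction hypothesis. *)
Lemma dickson_fun k (P : (nat -> nat) -> Prop) : exists c, forall f, P f ->
  exists g, P g /\ forall i, (i < k)%N -> (g i <= f i)%N /\ (g i <= c)%N.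
Proof.
elim: k P => [|k IH] P; first by exists 0%N => f Pf; exists f.
have [c0 c0P] := IH P.
have [v0 v0P] : exists v0, forall f, P f -> (forall i, (i < k)%N -> (f i <= c0)%N) ->
    exists g, P g /\ (forall i, (i < k)%N -> g i = f i) /\ (g k <= v0)%N.
  pose hit (p : {ffun 'I_k -> 'I_c0.+1}) v :=
    exists g, P g /\ (forall i : 'I_k, g i = p i) /\ g k = v.
  pose h p := epsilon (inhabits 0%N) (hit p).
  exists (\max_p h p)%N => f Pf fc.
  pose p := [ffun i : 'I_k => inord (f i) : 'I_c0.+1].
  have pE (i : 'I_k) : p i = f i :> nat by rewrite ffunE inordK // ltnS fc.
  have [g [Pg [gp gk]]] : hit p (h p).
    by apply: epsilon_spec; exists (f k), f; split=> //; split=> // i; rewrite pE.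
  exists g; split=> //; split=> [i ik|]; first by rewrite -(pE (Ordinal ik)) -gp.
  by rewrite gk; apply: (leq_bigmax p).
pose c v := epsilon (inhabits 0%N) (fun c => forall f, P f /\ f k = v ->
  exists g, (P g /\ g k = v) /\ forall i, (i < k)%N -> (g i <= f i)%N /\ (g i <= c)%N).
have cP v := epsilon_spec (inhabits 0%N) _ (IH (fun f => P f /\ f k = v)).
exists (maxn (maxn c0 v0) (\max_(v < v0) c v)) => f Pf.
have [fk | fk] := leqP v0 (f k).
  have [g [Pg gP]] := c0P f Pf; have [|g' [Pg' [g'E g'k]]] := v0P g Pg.
    by move=> i /gP [].
  exists g'; split=> // i; rewrite ltnS leq_eqVlt => /predU1P [->|ik].
    by rewrite (leq_trans g'k fk) !leq_max g'k orbT.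
  by rewrite g'E // !leq_max; case: (gP i ik) => -> ->.
have [g [[Pg gk] gP]] := cP (f k) f (conj Pf erefl).
exists g; split=> // i; rewrite ltnS leq_eqVlt => /predU1P [->|ik].
  by rewrite gk leqnn !leq_max (ltnW fk) orbT.
case: (gP i ik) => -> gc; split=> //; rewrite leq_max orbC; apply/orP; left.
exact: leq_trans gc (@leq_bigmax_cond _ predT (fun v : 'I_v0 => c v) (Ordinal fk) isT).
Qed.

Lemma dickson d (P : 'X_{1..d} -> Prop) : exists c, forall b, P b ->
  exists b', P b' /\ (b' <= b)%MM /\ (mdeg b' <= c)%N.
Proof.
pose ext (b : 'X_{1..d}) (n : nat) := nth 0%N b n.
have extE b (i : 'I_d) : ext b i = b i by rewrite (mnm_nth 0%N).
have [c cP] := dickson_fun d (fun f => exists b, P b /\ f = ext b).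
exists (d * c)%N => b Pb; have [|_ [[b' [Pb' ->]] b'P]] := cP (ext b); first by exists b.
exists b'; split=> //; split.
  by apply/mnm_lepP => i; rewrite -!extE; case: (b'P i (ltn_ord i)).
rewrite mdegE -[d in (_ <= d * _)%N]card_ord -sum_nat_const.
by apply: leq_sum => i _; rewrite -extE; case: (b'P i (ltn_ord i)).
Qed.

Section Leads.
Variables (F : fieldType) (A : F -> Prop) (d : nat) (x : 'I_d -> F).
Hypotheses (nA : noetherian A) (lA : local A) (gx : generates A x).
Implicit Types (b : 'X_{1..d}) (y z : F).
Let sA : subring A. Proof. by case: lA. Qed.
Let iM : ideal A (maxideal A). Proof. by case: lA. Qed.
Let Ax := generators_in lA gx.
Let iS Q : ideal A (monspan A x Q). Proof. exact: monspan_ideal. Qed.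

Definition Mgt b := monspan A x (fun m => (b < m)%O).
Definition Mge b := monspan A x (fun m => (b <= m)%O).
(** The unit multiple of x^b is the smallest term of [y]. Since monomials are compared first by
    degree, [Mgt b] lies between m^(deg b + 1) and m^(deg b). Nothing here makes [b] unique: that is
    [lead_uniq], after analytic independence. *)
Definition lead y b := exists u, isunit A u /\ Mgt b (y - u * mon x b).

Lemma mpow_Mgt n b y : (mdeg b < n)%N -> mpow A x n y -> Mgt b y.
Proof. by move=> bn; apply: monspanS => m /(leq_trans bn) /lt_mdeg_ltmc. Qed.

Lemma Mge_mpow b y : Mge b y -> mpow A x (mdeg b) y.
Proof. by apply: monspanS => m /lemc_mdeg. Qed.

Lemma Mgt_Mge b y : Mgt b y -> Mge b y.
Proof. by apply: monspanS => m /ltW. Qed.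

Lemma Mgt_mpow b y : Mgt b y -> mpow A x (mdeg b) y.
Proof. by move/Mgt_Mge/Mge_mpow. Qed.

Lemma Mgt_mul b b' y y' : Mgt b y -> Mge b' y' -> Mgt (b + b')%MM (y * y').
Proof. by apply: monspanM => // m m' ? ?; apply: ltmc_le_add. Qed.

Lemma Mge_mon b : Mge b (mon x b).
Proof. exact: monspan_mon1. Qed.

Lemma lead_Mge y b : lead y b -> Mge b y.
Proof.
move=> [u [[_ [Au _]] /Mgt_Mge yu]]; rewrite -(subrK (u * mon x b) y).
by apply: (idealD (iS _)) => //; apply: (idealM (iS _)) => //; apply: Mge_mon.
Qed.

Lemma Mgt_cases b y : Mgt b y -> y = 0 \/ exists b', (b < b')%O /\ Mge b' y.
Proof.
move=> [p [Ap [pb ->]]]; have [->|nz] := eqVneq p 0; first by left; rewrite meval0.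
right; exists (mlast p); split; first by apply: pb; rewrite -mcoeff_msupp mlast_supp.
by exists p; split=> //; split=> // m; rewrite -mcoeff_msupp => /mlast_lemc.
Qed.

(** The coefficient at [b] is a unit, which gives a lead, or lies in the maximal ideal, and then its
    term is absorbed in degree [mdeg b + 1]. *)
Lemma Mge_cases b y : Mge b y -> Mgt b y \/ lead y b.
Proof.
move=> [p [Ap [pb ->]]].
have rest : Mgt b (p.@[x] - p@_b * mon x b).
  exists (p - p@_b *: 'X_[b]); rewrite mevalB mevalZ; split.
    by apply: coefs_inB => //; apply: coefs_inZ => //; apply: coefs_inX.
  split=> // m; rewrite mcoeffB mcoeffZ mcoeffX; have [<-|bm] := eqVneq b m.
    by rewrite mulr1 subrr eqxx.
  by rewrite mulr0 subr0 => /pb; rewrite lt_neqAle bm.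
have [u|mx] := unit_or_max lA (Ap b); first by right; exists (p@_b).
left; rewrite -(subrK (p@_b * mon x b) p.@[x]); apply: (idealD (iS _)) => //.
apply: (@mpow_Mgt (1 + mdeg b)) => //; apply: mpowM => //; first exact/(mpow1 lA gx).
exact/Mge_mpow/Mge_mon.
Qed.

(** Takes the place of a terminating division algorithm. Only finitely many monomials have degree
    below [N], so unless [Y] meets m^N some element has a largest lead. Applied to a set of
    remainders, the second case is refuted by subtracting one more term; the first, for all [N], is
    the input of [krull_intersection]. *)
Lemma max_lead (Y : F -> Prop) N : (exists y, Y y) -> (forall y, Y y -> A y) ->
  (exists y, Y y /\ mpow A x N y) \/
  exists y b, Y y /\ (mdeg b < N)%N /\ lead y b /\ forall y', Y y' -> ~ Mgt b y'.
Proof.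
move=> [y0 Yy0] YA; case: (classic (exists y, Y y /\ mpow A x N y)) => [|no]; [by left|right].
have N0 : (0 < N)%N.
  case: N no => // -[]; exists y0; split=> //; apply: mpow0 => //; exact: YA.
have b0P : (mdeg (0%MM : 'X_{1..d}) < N)%N by rewrite mdeg0.
pose P (b : 'X_{1..d < N}) := asbool (exists y, Y y /\ Mge b y).
have P0 : P (BMultinom b0P).
  apply/asboolP; exists y0; split=> //; apply: monspanS (mpow0 x lA (YA _ Yy0)) => m _.
  exact: le0m.
have [b /asboolP [y [Yy yb]] bmax] := arg_maxP (fun b : 'X_{1..d < N} => (b : 'X_{1..d})) P0.
have key y' : Y y' -> ~ Mgt b y'.
  move=> Yy' /Mgt_cases [y'0|[b' [bb' y'b']]].
    by apply: no; exists y'; split=> //; rewrite y'0; apply: ideal0 (iS _).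
  have [b'N|Nb'] := ltnP (mdeg b') N.
    have /bmax /= : P (BMultinom b'N) by apply/asboolP; exists y'.
    by rewrite leNgt bb'.
  by apply: no; exists y'; split=> //; apply: mpow_le Nb' (Mge_mpow y'b').
exists y, b; split=> //; split; first exact: bmdeg.
split=> //; have [h|//] := Mge_cases yb; by case: (key y Yy).
Qed.

Lemma lead_exists y : A y -> y != 0 -> exists b, lead y b.
Proof.
move=> Ay nz; apply: NNPP => no; apply: (negP nz); apply/eqP.
apply: (krull_intersection lA gx nA (ideal_zero sA)) => N.
have [|z ->|[z [-> ?]]|[z [b [-> [_ [yb _]]]]]] := @max_lead (fun z => z = y) N.
- by exists y.
- by [].
- by exists 0, y; rewrite add0r.
- by case: no; exists b.
Qed.

(* The leading monomials of J = P + aA are finitely generated, so reducing an element of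
   J /\ m^n by elements of J of bounded leading degree keeps the multipliers in m^(n - c). *)
Lemma artin_rees_colon P a : prime_ideal A P -> A a -> ~ P a -> exists c, forall n y,
  A y -> idsum P (mpow A x n) (a * y) -> idsum P (mpow A x (n - c)) y.
Proof.
move=> [iP [_ pP]] Aa nPa; pose J := idsum P (mult A a).
have iJ : ideal A J by apply: idsum_ideal => //; apply: mult_ideal => //; apply: ideal_self.
have [c cP] := @dickson d (fun b => exists y, J y /\ Mgt b (y - mon x b)).
exists c => n y Ay [w [v [Pw [vn ayE]]]].
pose K := idsum P (mult (mpow A x (n - c)) a).
have iK : ideal A K by apply: idsum_ideal => //; apply: mult_ideal => //; apply: iS.
have KJ z : K z -> J z.
  move=> [p [_ [Pp [[s [/(idealS (iS _)) As ->]] ->]]]]; exists p, (a * s).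
  by split=> //; split=> //; exists s.
have Jv : J v.
  exists (- w), (a * y); split; first exact: (idealN iP sA).
  by split; [exists y | rewrite ayE; ring].
have [p [_ [Pp [[s [sn ->]] vE]]]] : K v.
  apply: (krull_intersection lA gx nA iK) => N.
  have [||[z [[w' [Kw' [_ zE]]] zN]]|] :=
      @max_lead (fun z => exists w', K w' /\ mpow A x n w' /\ z = v - w') N.
  - by exists v, 0; rewrite subr0; split; [apply: ideal0 iK | split=> //; apply: ideal0 (iS _)].
  - by move=> z [w' [/(idealS iK) Aw' [_ ->]]]; apply: (subringB sA) => //; apply: (idealS (iS _)) vn.
  - by exists w', z; rewrite zE; split=> //; split; [rewrite -zE | ring].
  move=> [z [b [[w' [Kw' [w'n zE]]] [_ [[u [uu zb]] bmax]]]]]; exfalso.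
  case: (uu) => u0 [Au Aiu].
  have Jz : J z by rewrite zE; apply: (idealB iJ sA) => //; apply: KJ.
  have zn : mpow A x n z by rewrite zE; apply: (idealB (iS _) sA).
  have nb : (n <= mdeg b)%N.
    by rewrite leqNgt; apply/negP => bn; apply: (bmax z _ (mpow_Mgt bn zn)); exists w'.
  have [|b' [[y'' [Jy'' y''b']] [b'b b'c]]] := cP b.
    exists (u^-1 * z); split; first exact: (idealM iJ).
    have -> : u^-1 * z - mon x b = u^-1 * (z - u * mon x b) by field.
    exact: (idealM (iS _)).
  pose g := (b - b')%MM; have gb : (g + b')%MM = b by apply: submK.
  have gn : (n - c <= mdeg g)%N by move: nb; rewrite -gb mdegD; lia.
  (* A multiple of [y''] with the same leading term [u * mon x b] as [z]. As [g] has degree at least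
     [n - c], it lies in [K], so [z - t] is again a remainder, with a larger lead. *)
  pose t := u * mon x g * y''.
  have Ag : A (u * mon x g) by apply: (subringM sA) => //; apply: mon_in.
  have tb : Mgt b (t - u * mon x b).
    have -> : t - u * mon x b = u * ((y'' - mon x b') * mon x g).
      by rewrite /t -gb monD; ring.
    apply: (idealM (iS _)) => //; rewrite -gb addmC.
    by apply: Mgt_mul => //; apply: Mge_mon.
  have Kt : K t.
    have [p [_ [Pp [[s [As ->]] y''E]]]] := Jy''.
    exists (u * mon x g * p), (a * (u * mon x g * s)); split; first exact: (idealM iP).
    split; last by rewrite /t y''E; ring.
    exists (u * mon x g * s); split=> //; rewrite -mulrA mulrCA.
    rewrite mulrC; apply: (idealM (iS _)); first exact: (subringM sA).
    exact: monspan_mon1.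
  have tn : mpow A x n t.
    rewrite -(subrK (u * mon x b) t); apply: (idealD (iS _)).
      exact: mpow_le nb (Mgt_mpow tb).
    by apply: (idealM (iS _)) => //; apply: monspan_mon1.
  apply: (bmax (z - t)).
    exists (w' + t); split; first exact: (idealD iK).
    by split; [apply: (idealD (iS _)) | rewrite zE; ring].
  have -> : z - t = (z - u * mon x b) - (t - u * mon x b) by ring.
  exact: (idealB (iS _) sA).
have As : A s := idealS (iS _) sn.
have [|//|Pys] := pP a (y - s) Aa (subringB sA Ay As).
  have -> : a * (y - s) = w + p by rewrite mulrBr ayE vE; ring.
  exact: (idealD iP).
by exists (y - s), s; rewrite subrK.
Qed.

End Leads.

(** * Analytic independence of regular parameters *)

Section IndependentSequences.
Variables (F : fieldType) (A : F -> Prop) (sA : subring A).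
Implicit Types (I J : F -> Prop) (ys ws : seq F).

(** For an [indep] list the ideals generated by its successive tails increase strictly from [I], so
    its size bounds the length of [A / I] from below. *)
Fixpoint gen I ys : F -> Prop :=
  if ys is y :: ys' then fun z => exists c, A c /\ gen I ys' (z - c * y) else I.

(* Each entry lies outside the ideal generated by I and the entries to its right. *)
Fixpoint indep I ys : Prop :=
  if ys is y :: ys' then A y /\ ~ gen I ys' y /\ indep I ys' else True.

Lemma gen_base I ys z : I z -> gen I ys z.
Proof.
elim: ys z => //= y ys IH z Iz; exists 0; split; first exact: subring0.
by rewrite mul0r subr0; apply: IH.
Qed.

Lemma gen_ideal I ys : ideal A I -> (forall y, y \in ys -> A y) -> ideal A (gen I ys).
Proof.
move=> iI; elim: ys => //= y ys IH Ay.
have {}IH : ideal A (gen I ys) by apply: IH => w wys; apply: Ay; rewrite inE wys orbT.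
have Ay0 : A y by apply: Ay; rewrite inE eqxx.
split=> [z [c [Ac /(idealS IH) h]]|].
  by rewrite -(subrK (c * y) z); apply: (subringD sA) => //; apply: (subringM sA).
split; first by exists 0; rewrite mul0r subr0; split; [apply: subring0 | apply: ideal0 IH].
split=> [z w [c [Ac h]] [c' [Ac' h']] | a z Aa [c [Ac h]]].
  exists (c + c'); split; first exact: (subringD sA).
  have -> : z + w - (c + c') * y = (z - c * y) + (w - c' * y) by ring.
  exact: (idealD IH).
exists (a * c); split; first exact: (subringM sA).
have -> : a * z - a * c * y = a * (z - c * y) by ring.
exact: (idealM IH).
Qed.

Lemma gen_split I ys z : gen I ys z -> exists e g, I e /\ gen (fun w => w = 0) ys g /\ z = e + g.
Proof.
elim: ys z => /= [|y ys IH] z; first by exists z, 0; rewrite addr0.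
move=> [c [Ac /IH [e [g [Ie [h zE]]]]]]; exists e, (g + c * y); split=> //; split.
  by exists c; rewrite addrK.
by rewrite addrA -zE subrK.
Qed.

Lemma gen_add I ys e g : I e -> gen (fun w => w = 0) ys g -> gen I ys (e + g).
Proof.
move=> Ie; elim: ys g => /= [|y ys IH] g; first by move=> ->; rewrite addr0.
by move=> [c [Ac /IH h]]; exists c; rewrite -addrA.
Qed.

Lemma gen_scaled_cat I a ws ts z : gen I (map ( *%R a) ws ++ ts) z ->
  exists e g, gen I ts e /\ gen (fun w => w = 0) ws g /\ z = e + a * g.
Proof.
elim: ws z => /= [|w ws IH] z; first by exists z, 0; rewrite mulr0 addr0.
move=> [c [Ac /IH [e [g [Ie [h zE]]]]]]; exists e, (g + c * w); split=> //; split.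
  by exists c; rewrite addrK.
by rewrite -(subrK (c * (a * w)) z) zE; ring.
Qed.

Lemma indep_in I ys : indep I ys -> forall y, y \in ys -> A y.
Proof.
elim: ys => //= y ys IH [Ay [_ /IH h]] z; rewrite inE => /predU1P [->//|]; exact: h.
Qed.
End IndependentSequences.

Section DimensionGrowth.
Variables (F : fieldType) (A : F -> Prop) (d : nat) (x : 'I_d -> F).
Hypotheses (nA : noetherian A) (lA : local A) (gx : generates A x).
Implicit Types (b : 'X_{1..d}) (y z : F).
Let sA : subring A. Proof. by case: lA. Qed.
Let Ax := generators_in lA gx.
Let iS Q : ideal A (monspan A x Q). Proof. exact: monspan_ideal. Qed.

Fixpoint power_blocks (a : F) ys i n :=
  if n is n'.+1 then map ( *%R (a ^+ i)) ys ++ power_blocks a ys i.+1 n' else [::].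

Lemma size_power_blocks a ys i n : size (power_blocks a ys i n) = (n * size ys)%N.
Proof. by elim: n i => //= n IH i; rewrite size_cat size_map IH mulSn. Qed.

(** In a relation at block [i], the later blocks contribute only multiples of a^(i+1). Dividing by
    a^i modulo [P] costs [c * i <= c * n] in the exponent, and the remaining multiple of [a] is in
    [Q]. What is left is a relation among the [ys] modulo [Q + m^n0]. *)
Lemma growth_step P Q a n0 n c ys : prime_ideal A P -> ideal A Q -> ssub P Q ->
  Q a -> ~ P a ->
  (forall k y, A y -> idsum P (mpow A x k) (a * y) -> idsum P (mpow A x (k - c)) y) ->
  indep A (idsum Q (mpow A x n0)) ys ->
  indep A (idsum P (mpow A x (n0 + c * n))) (power_blocks a ys 0 n).
Proof.
move=> pP iQ [PQ _] Qa nPa cP ysI; have iP : ideal A P by case: pP.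
have Aa : A a := idealS iQ Qa.
have Ays := indep_in ysI.
set I := idsum P (mpow A x (n0 + c * n)).
have iI : ideal A I := idsum_ideal sA iP (iS _).
have ARX i y k : A y -> idsum P (mpow A x k) (a ^+ i * y) -> idsum P (mpow A x (k - c * i)) y.
  elim: i k => [|i IH] k Ay; first by rewrite mul1r muln0 subn0.
  rewrite exprS -mulrA => /cP h; rewrite mulnS subnDA; apply: IH => //; apply: h.
  by apply: (subringM sA) => //; apply: (subringX sA).
have Apb i k y : y \in power_blocks a ys i k -> A y.
  elim: k i => //= k IH i; rewrite mem_cat => /orP [/mapP [w wys ->]|]; last exact: IH.
  by apply: (subringM sA); [apply: (subringX sA) | apply: Ays].
have tail i k z : gen A I (power_blocks a ys i k) z ->
    exists e r, I e /\ A r /\ z = e + a ^+ i * r.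
  elim: k i z => /= [|k IH] i z.
    by move=> Iz; exists z, 0; rewrite mulr0 addr0; do !split=> //; apply: subring0.
  move/gen_scaled_cat => [e [g [/IH [e' [r [Ie' [Ar eE]]]] [gP zE]]]].
  have Ag : A g := idealS (gen_ideal sA (ideal_zero sA) Ays) gP.
  exists e', (a * r + g); split=> //; split.
    by apply: (subringD sA) => //; apply: (subringM sA).
  by rewrite zE eE exprS; ring.
have main i k : (i + k = n)%N -> indep A I (power_blocks a ys i k).
  elim: k i => //= k IH i ikn.
  have {}IH : indep A I (power_blocks a ys i.+1 k) by apply: IH; rewrite addSnnS.
  suff : forall ws, indep A (idsum Q (mpow A x n0)) ws ->
      indep A I (map ( *%R (a ^+ i)) ws ++ power_blocks a ys i.+1 k) by apply.
  elim=> //= y ws IHw [Ay [nyg wsI]].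
  split; first by apply: (subringM sA) => //; apply: (subringX sA).
  split; last exact: IHw.
  move/gen_scaled_cat => [e [g [/tail [e' [r [Ie' [Ar eE]]]] [gP yE]]]]; apply: nyg.
  have Ag : A g := idealS (gen_ideal sA (ideal_zero sA) (indep_in wsI)) gP.
  have Aar : A (a * r) by apply: (subringM sA).
  have := @ARX i (y - a * r - g) (n0 + c * n)%N.
  have -> : a ^+ i * (y - a * r - g) = e'.
    by rewrite 2!mulrBr yE eE exprS; ring.
  case=> //; first by do 2!apply: (subringB sA) => //.
  move=> p [v [Pp [vn hE]]].
  have -> : y = (p + a * r + v) + g by rewrite -(subrK (a * r) y) -(subrK g (y - _)) hE; ring.
  apply: gen_add => //; exists (p + a * r), v; split.
    by apply: (idealD iQ); [apply: PQ | rewrite mulrC; apply: (idealM iQ)].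
  split=> //; apply: mpow_le vn; rewrite -addnBA ?leq_addr // leq_mul2l.
  by rewrite -ikn leq_addr orbT.
exact: (main 0%N n).
Qed.

(* The blocks a^i ys with a in P_1 \ P_0 multiply the growth of A / P_1 by n: Artin-Rees
   makes the loss of precision linear in i. *)
Lemma prime_chain_growth k (P : nat -> F -> Prop) :
  (forall j, (j <= k)%N -> prime_ideal A (P j)) ->
  (forall j, (j < k)%N -> ssub (P j) (P j.+1)) ->
  exists C, forall n, (0 < n)%N -> exists ys,
    size ys = (n ^ k)%N /\ indep A (idsum (P 0%N) (mpow A x (C * n))) ys.
Proof.
elim: k P => [|k IH] P pP PS.
  exists 1%N => n n0; exists [:: 1]; split=> //=; split; first exact: subring1.
  split=> // -[p [v [Pp [vn oneE]]]]; apply: (max1 lA); rewrite oneE.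
  have [iP [nP1 _]] := pP 0%N isT; case: (lA) => _ iM; apply: (idealD iM).
    exact: (proper_ideal_max lA iP nP1).
  by apply/(mpow1 lA gx); apply: mpow_le vn; rewrite mul1n.
have [||C CP] := IH (fun j => P j.+1); [by move=> j; apply: (pP j.+1) | by move=> j; apply: (PS j.+1)|].
have [PQ [a [Qa nPa]]] := PS 0%N isT.
have iQ : ideal A (P 1%N) by case: (pP 1%N isT).
have [c cP] := artin_rees_colon nA lA gx (pP 0%N isT) (idealS iQ Qa) nPa.
exists (C + c)%N => n n0; have [ys [sys ysI]] := CP n n0.
exists (power_blocks a ys 0 n); rewrite size_power_blocks sys expnS mulnDl; split=> //.
exact: (growth_step n (pP 0%N isT) iQ (PS 0%N isT) Qa nPa cP ysI).
Qed.

(** Each entry of [ys] enlarges the ideal; among the new elements pick one with largest lead [b]. If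
    [b] were already a lead of the smaller ideal, subtracting a multiple would give a new element
    with larger lead. Distinct monomials thus count the independent elements. *)
Lemma indep_leads n ys : indep A (mpow A x n) ys -> exists s : seq 'X_{1..d},
  size s = size ys /\ uniq s /\ forall b, b \in s ->
    [/\ (mdeg b < n)%N, ~ Mgt A x b (mon x b) &
        exists w, gen A (mpow A x n) ys w /\ lead A x w b].
Proof.
elim: ys => [|y ys IH] /= h; first by exists [::].
have Ays : forall w, w \in y :: ys -> A w by apply: (@indep_in _ A (mpow A x n) (y :: ys)).
case: h => Ay [ny ysI]; have [s [ss [us sP]]] := IH ysI.
have iG : ideal A (gen A (mpow A x n) (y :: ys)) := gen_ideal sA (iS _) Ays.
have iG' : ideal A (gen A (mpow A x n) ys).
  by apply: (gen_ideal sA (iS _)) => w wys; apply: Ays; rewrite inE wys orbT.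
have GS w : gen A (mpow A x n) ys w -> gen A (mpow A x n) (y :: ys) w.
  by move=> h; exists 0; rewrite mul0r subr0; split=> //; apply: subring0.
have [||[w [[_ nw] wn]]|] := @max_lead _ A _ x lA gx
    (fun w => gen A (mpow A x n) (y :: ys) w /\ ~ gen A (mpow A x n) ys w) n.
- exists y; split=> //; exists 1; rewrite mul1r subrr.
  by split; [apply: subring1 | apply: ideal0 iG'].
- by move=> w [/(idealS iG)].
- by case: nw; apply: gen_base.
move=> [w [b [[Gw nGw] [bn [wb bmax]]]]].
case: (wb) => u [[u0 [Au Aiu]] wu].
exists (b :: s); split; first by rewrite /= ss.
split.
  rewrite /= us andbT; apply/negP => /sP [_ _ [w' [Gw' [u' [[u'0 [Au' Aiu']] w'u']]]]].
  have Auu : A (u * u'^-1) by apply: (subringM sA).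
  apply: (bmax (w - u * u'^-1 * w')).
    split; first by apply: (idealB iG) => //; apply: (idealM iG) => //; apply: GS.
    move=> h; apply: nGw; rewrite -(subrK (u * u'^-1 * w') w).
    by apply: (idealD iG') => //; apply: (idealM iG').
  have -> : w - u * u'^-1 * w' = (w - u * mon x b) - u * u'^-1 * (w' - u' * mon x b) by field.
  by apply: (idealB (iS _)) => //; apply: (idealM (iS _)).
move=> b'; rewrite inE => /predU1P [->|/sP [? ? [v [/GS ? ?]]]]; last by split=> //; exists v.
split=> //; last by exists w.
move=> h; apply: (bmax w) => //; rewrite -(subrK (u * mon x b) w).
by apply: (idealD (iS _)) => //; apply: (idealM (iS _)).
Qed.

End DimensionGrowth.

(** If x^a does not divide x^b, some coordinate of [b] is below that of [a]: it is encoded by its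
    index ([d'.+1] choices) and its value (at most [mdeg a]), and the other [d'] coordinates are
    below [n]. One coordinate is bounded independently of [n], so the exponent of [n.+1] drops to
    [d']. *)
Lemma count_not_above d' n (a : 'X_{1..d'.+1}) (s : seq 'X_{1..d'.+1}) : uniq s ->
  (forall b, b \in s -> (mdeg b < n)%N /\ ~~ (a <= b)%MM) ->
  (size s <= d'.+1 * (mdeg a).+1 * n.+1 ^ d')%N.
Proof.
move=> us sP.
have le_mdeg (b : 'X_{1..d'.+1}) i : (b i <= mdeg b)%N.
  by rewrite mdegE (bigD1 i) //= leq_addr.
pose idx (b : 'X_{1..d'.+1}) := odflt ord0 [pick i | (b i < a i)%N].
pose enc (b : 'X_{1..d'.+1}) : 'I_d'.+1 * 'I_(mdeg a).+1 * {ffun 'I_d' -> 'I_n.+1} :=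
  (idx b, inord (b (idx b)), [ffun j => inord (b (lift (idx b) j))]).
have idxP b : b \in s -> (b (idx b) < a (idx b))%N.
  move=> /sP [_ nab]; rewrite /idx; case: pickP => //= none.
  by case/negP: nab; apply/mnm_lepP => i; rewrite leqNgt none.
have bd b : b \in s -> (b (idx b) < (mdeg a).+1)%N.
  by move/idxP/leq_trans; apply; apply/leqW/le_mdeg.
have encI : {in s &, injective enc}.
  move=> b b' bs bs' [ieq veq feq]; apply/mnmP => i.
  have [-> | [j ->]] : i = idx b \/ exists j, i = lift (idx b) j.
    by case: (unliftP (idx b) i) => [j ->|->]; [right; exists j | left].
  - by move/(congr1 val): veq; rewrite /= (inordK (bd b bs)) (inordK (bd b' bs')) -ieq.
  move/ffunP/(_ j): feq; rewrite !ffunE => /(congr1 val) /=.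
  have [bn _] := sP b bs; have [bn' _] := sP b' bs'.
  rewrite !inordK ?ieq // ltnS ?(leq_trans (le_mdeg _ _)) //; exact: ltnW.
rewrite -(size_map enc) -(card_uniqP _); last by rewrite map_inj_in_uniq.
by apply: (leq_trans (max_card _)); rewrite !card_prod !card_ord card_ffun !card_ord.
Qed.

(** If x^b were in [Mgt b], then so would be each multiple of x^b with respect to its own exponent,
    and the leads of [indep_leads] would all avoid the multiples of x^b. Their number then grows at
    most like n^d', while a prime chain with [d'.+1] inclusions yields n^(d'+1) of them. *)
Theorem analytic_independence (F : fieldType) (A : F -> Prop) d' (x : 'I_d'.+1 -> F) b :
  noetherian A -> local A -> generates A x -> prime_chain A d'.+1 ->
  ~ Mgt A x b (mon x b).
Proof.
move=> nA lA gx [P [pP PS]] rel; have sA : subring A by case: lA.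
have [C CP] := prime_chain_growth nA lA gx pP PS.
(* Since [C * n + 1 <= C.+1 * n], the count is at most [d'.+1 * (mdeg b).+1 * C.+1 ^ d' * n ^ d'],
   and [n] exceeds the factor in front of [n ^ d'] by one. *)
pose n := (d'.+1 * (mdeg b).+1 * C.+1 ^ d').+1.
have [ys [sys ysI]] := CP n isT.
have {}ysI : indep A (mpow A x (C * n)) ys.
  elim: ys {sys} ysI => //= y ys IH [Ay [ny /IH h]]; split=> //; split=> // gy; apply: ny.
  have [e [g [en [gP ->]]]] := gen_split gy; apply: gen_add => //.
  by case: (pP 0%N isT) => iP _; apply: (idsumR iP).
have [s [ss [us sP]]] := indep_leads lA gx ysI.
have hs b' : b' \in s -> (mdeg b' < C * n)%N /\ ~~ (b <= b')%MM.
  move=> /sP [b'n nb' _]; split=> //; apply/negP => bb'; apply: nb'.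
  rewrite -(submK bb') addmC monD; apply: Mgt_mul => //.
  exact: Mge_mon.
have := count_not_above us hs; rewrite ss sys leqNgt => /negP; apply.
apply: (@leq_ltn_trans (d'.+1 * (mdeg b).+1 * (C.+1 ^ d' * n ^ d'))).
  rewrite leq_mul2l -expnMn; apply/orP; right.
  have le_base : ((C * n).+1 <= C.+1 * n)%N by rewrite mulSn -add1n leq_add2r.
  have le_exp e : ((C * n).+1 ^ e <= (C.+1 * n) ^ e)%N.
    by elim: e => // e IH; rewrite !expnS leq_mul.
  exact: le_exp.
by rewrite mulnA expnS ltn_pmul2r ?expn_gt0.
Qed.

(** * Normality and intersections of discrete valuation rings *)

(** For a Noetherian domain this is integral closedness, by the determinant trick. Stable ideals are
    the form in which it is met in [localization_dvr_separation]. *)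
Definition completely_normal (F : fieldType) (A : F -> Prop) :=
  forall (I : F -> Prop) c z, ideal A I -> I c -> c != 0 ->
    (forall y, I y -> I (z * y)) -> A z.

Definition has_order (F : fieldType) (A : F -> Prop) y n :=
  idpow A (maxideal A) n y /\ ~ idpow A (maxideal A) n.+1 y.

Section RegularLeads.
Variables (F : fieldType) (A : F -> Prop) (d : nat) (x : 'I_d -> F).
Hypotheses (nA : noetherian A) (lA : local A) (gx : generates A x).
Hypothesis indx : forall b, ~ Mgt A x b (mon x b).
Implicit Types (b : 'X_{1..d}) (y z : F).
Let sA : subring A. Proof. by case: lA. Qed.
Let Ax := generators_in lA gx.
Let iS Q : ideal A (monspan A x Q). Proof. exact: monspan_ideal. Qed.
Local Notation Mgt := (Mgt A x).
Local Notation Mge := (Mge A x).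
Local Notation lead := (lead A x).

Lemma lead_not_Mgt y b : lead y b -> ~ Mgt b y.
Proof.
move=> [u [[u0 [Au Aiu]] h]] yb; apply: (indx (b := b)).
have -> : mon x b = u^-1 * (y - (y - u * mon x b)) by field.
by apply: (idealM (iS _)) => //; apply: (idealB (iS _)).
Qed.

Lemma lead_neq0 y b : lead y b -> y != 0.
Proof. by move/lead_not_Mgt=> h; apply/eqP => y0; apply: h; rewrite y0; apply: ideal0 (iS _). Qed.

Lemma lead_uniq y b b' : lead y b -> lead y b' -> b = b'.
Proof.
move=> h h'; apply/eqP; case: (ltgtP b b') => // bb'.
  by case: (lead_not_Mgt h); apply: monspanS (lead_Mge lA gx h') => m; apply: lt_le_trans.
by case: (lead_not_Mgt h'); apply: monspanS (lead_Mge lA gx h) => m; apply: lt_le_trans.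
Qed.

Lemma leadM y y' b b' : lead y b -> lead y' b' -> lead (y * y') (b + b')%MM.
Proof.
move=> h [u' [uu' h']]; case: (h) => u [uu hu]; exists (u * u'); split; first exact: unitM.
rewrite monD.
have -> : y * y' - u * u' * (mon x b * mon x b') =
  (y - u * mon x b) * (u' * mon x b') + (y' - u' * mon x b') * y by ring.
case: uu' => _ [Au' _]; apply: (idealD (iS _)).
  by apply: Mgt_mul => //; apply: (idealM (iS _)) => //; apply: Mge_mon.
by rewrite addmC; apply: Mgt_mul => //; apply: lead_Mge.
Qed.

Lemma leadX y b n : lead y b -> lead (y ^+ n) (b *+ n)%MM.
Proof.
move=> h; elim: n => [|n IH]; last by rewrite exprS mulmS; apply: leadM.
rewrite expr0 mulm0n; exists 1; split; first exact: unit1.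
by rewrite mon0 mulr1 subrr; apply: ideal0 (iS _).
Qed.

Lemma lead_mpow y b n : lead y b -> mpow A x n y <-> (n <= mdeg b)%N.
Proof.
move=> h; split=> [yn|nb]; last exact: mpow_le nb (Mge_mpow (lead_Mge lA gx h)).
by rewrite leqNgt; apply/negP => bn; apply: (lead_not_Mgt h); apply: mpow_Mgt bn yn.
Qed.

Lemma lead_has_order y b : lead y b -> has_order A y (mdeg b).
Proof.
move=> h; split; first by apply/(idpowP lA gx)/(lead_mpow _ h).
by move/(idpowP lA gx)/(lead_mpow _ h); rewrite ltnn.
Qed.

Lemma has_order_exists y : A y -> y != 0 -> exists n, has_order A y n.
Proof.
by move=> Ay /(lead_exists nA lA gx Ay) [b /lead_has_order h]; exists (mdeg b).
Qed.

Lemma has_order_neq0 y n : has_order A y n -> y != 0.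
Proof.
move=> [_ h]; apply/eqP => y0; apply: h; rewrite y0.
by apply/(idpowP lA gx); apply: ideal0 (iS _).
Qed.

Lemma has_order_in y n : has_order A y n -> A y.
Proof. by move=> [/(idpowP lA gx) h _]; apply: (idealS (iS _)) h. Qed.

Lemma has_orderP y n k : has_order A y n -> idpow A (maxideal A) k y <-> (k <= n)%N.
Proof.
move=> [/(idpowP lA gx) yn nyn]; split=> [/(idpowP lA gx) yk|kn].
  rewrite leqNgt; apply/negP => nk; apply: nyn; apply/(idpowP lA gx).
  exact: mpow_le nk yk.
by apply/(idpowP lA gx); apply: mpow_le kn yn.
Qed.

Lemma has_order_lead y n : has_order A y n -> exists b, lead y b /\ mdeg b = n.
Proof.
move=> h; have [b hb] := lead_exists nA lA gx (has_order_in h) (has_order_neq0 h).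
exists b; split=> //; apply/eqP; rewrite eqn_leq; apply/andP; split.
  by apply/(has_orderP _ h)/(idpowP lA gx)/(lead_mpow _ hb).
by apply/(lead_mpow _ hb)/(idpowP lA gx)/(has_orderP _ h).
Qed.

Lemma has_orderM y y' n n' : has_order A y n -> has_order A y' n' ->
  has_order A (y * y') (n + n').
Proof.
move=> /has_order_lead [b [hb <-]] /has_order_lead [b' [hb' <-]].
by rewrite -mdegD; apply: lead_has_order; apply: leadM.
Qed.

(* If z I <= I and c in I then c z^n is in A for all n, so comparing exponents as n grows,
   the leading monomial of c divides that of c z; subtracting multiples of c thus pushes
   c z into arbitrarily high powers of the maximal ideal. *)
Lemma regular_completely_normal : completely_normal A.
Proof.
move=> I c z iI Ic c0 zI; have Ac : A c := idealS iI Ic.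
have Acz : A (z * c) by apply: (idealS iI); apply: zI.
have iJ : ideal A (mult A c) by apply: mult_ideal => //; apply: ideal_self.
suff [t [At /eqP]] : mult A c (z * c) by rewrite mulrC (inj_eq (mulfI c0)) => /eqP ->.
apply: (krull_intersection lA gx nA iJ) => N.
have [|w [t [At ->]]|[w [[t [At wE]] wN]]|[w [b [[t [At wE]] [_ [wb bmax]]]]]] :=
    @max_lead _ A _ x lA gx (fun w => exists t, A t /\ w = z * c - c * t) N.
- by exists (z * c), 0; rewrite mulr0 subr0; split=> //; apply: subring0.
- by apply: (subringB sA) => //; apply: (subringM sA).
- by exists (c * t), w; rewrite wE; split; [exists t | split; [rewrite -wE | ring]].
exfalso; pose z' := z - t; have wz' : w = c * z' by rewrite wE /z'; ring.
have z'I y : I y -> I (z' * y).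
  by move=> Iy; rewrite mulrBl; apply: (idealB iI sA); [apply: zI | apply: (idealM iI)].
have z'0 : z' != 0 by apply: contraNneq (lead_neq0 wb); rewrite wz' => ->; rewrite mulr0.
have z'XI n : I (z' ^+ n * c) by elim: n => [|n IH]; rewrite ?mul1r // exprS -mulrA; apply: z'I.
have [k ck] := lead_exists nA lA gx Ac c0.
have kb : (k <= b)%MM.
  (* Comparing the leads of the two sides of [c * w ^+ n = c ^+ n * (z' ^+ n * c)] gives
     [k + n b = n k + o], hence [n * b i >= (n - 1) * k i]. With [n = k i + 1] this excludes
     [b i < k i]. *)
  apply/mnm_lepP => i; pose n := (k i).+1.
  have [|o ho] := lead_exists nA lA gx (idealS iI (z'XI n)).
    by rewrite mulf_neq0 // expf_neq0.
  have := lead_uniq (leadM ck (leadX n wb)).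
  have -> : c * w ^+ n = c ^+ n * (z' ^+ n * c) by rewrite wz' exprMn; ring.
  move/(_ _ (leadM (leadX n ck) ho)) => /mnmP /(_ i).
  rewrite !mnmDE !mulmnE /n; nia.
case: wb => u [[u0 [Au Aiu]] wu]; case: ck => v [[v0 [Av Aiv]] cv].
pose g := (b - k)%MM; have gk : (g + k)%MM = b by apply: submK.
apply: (bmax (w - c * (u * v^-1 * mon x g))).
  exists (t + u * v^-1 * mon x g); split; last by rewrite wE; ring.
  by apply: (subringD sA) => //; apply: (subringM sA); [apply: (subringM sA) | apply: mon_in].
have -> : w - c * (u * v^-1 * mon x g) =
    (w - u * mon x b) - u * v^-1 * ((c - v * mon x k) * mon x g).
  by rewrite -gk monD; field.
apply: (idealB (iS _)) => //; apply: (idealM (iS _)); first exact: (subringM sA).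
by rewrite -gk addmC; apply: Mgt_mul => //; apply: Mge_mon.
Qed.

End RegularLeads.

(** * Localizations, and discrete valuation rings separating them from outside elements *)

Section Localization.
Variables (F : fieldType) (A : F -> Prop) (sA : subring A).

Definition loc (M : F -> Prop) y := exists a s, A a /\ M s /\ y = a / s.

Definition mult_set (M : F -> Prop) :=
  M 1 /\ (forall s t, M s -> M t -> M (s * t)) /\ (forall s, M s -> A s /\ s != 0).

Lemma loc_in M y : mult_set M -> A y -> loc M y.
Proof. by move=> [M1 _] Ay; exists y, 1; rewrite divr1. Qed.

Lemma loc_inv M s : mult_set M -> M s -> loc M s^-1.
Proof. by move=> _ Ms; exists 1, s; rewrite div1r; split=> //; apply: subring1. Qed.

Lemma loc_subring M : mult_set M -> subring (loc M).
Proof.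
move=> hM; case: (hM) => M1 [MM MA]; split; first by apply: loc_in => //; apply: subring1.
split=> y y' [a [s [Aa [Ms ->]]]] [a' [s' [Aa' [Ms' ->]]]].
  have [As s0] := MA _ Ms; have [As' s'0] := MA _ Ms'.
  exists (a * s' - a' * s), (s * s'); split; last by split; [apply: MM | field; rewrite s'0 s0].
  by apply: (subringB sA); apply: (subringM sA).
exists (a * a'), (s * s'); split; first exact: (subringM sA).
by split; [apply: MM | rewrite invfM mulrACA].
Qed.

Lemma prime_compl_mult_set Q : prime_ideal A Q -> mult_set (fun s => A s /\ ~ Q s).
Proof.
move=> [iQ [nQ1 pQ]]; split; first by split=> //; apply: subring1.
split=> [s t [As nQs] [At nQt]|s [As nQs]].
  by split; [apply: (subringM sA) | move/(pQ _ _ As At) => []].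
by split=> //; apply/eqP => s0; apply: nQs; rewrite s0; apply: ideal0 iQ.
Qed.

End Localization.

Section UniformizerDvr.
Variables (F : fieldType) (W : F -> Prop) (p : F).
Hypotheses (sW : subring W) (Wp : W p) (nWp : ~ W p^-1).
Hypothesis fac : forall z, z != 0 -> exists n u,
  isunit W u /\ (z = p ^+ n * u \/ z^-1 = p ^+ n * u).

(** A nonzero ideal is generated by the least power of [p] that it contains. The alternative in
    [fac] between [z] and [z^-1] avoids negative exponents. *)
Lemma uniformizer_dvr : dvr W.
Proof.
have vW : valuation_ring W.
  split=> // z /fac [n [u [[u0 [Wu _]] [->|->]]]]; [left | right];
  by apply: (subringM sW) => //; apply: (subringX sW).
split=> //; split; last by exists p^-1.
have p0 : p != 0 by apply/eqP => p0; apply: nWp; rewrite p0 invr0; apply: subring0.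
have facW z : W z -> z != 0 -> exists n u, isunit W u /\ z = p ^+ n * u.
  move=> Wz z0; have [n [u [uu [zE|zE]]]] := fac z0; first by exists n, u.
  case: (uu) => u0 [Wu Wiu]; case: n zE => [|n] zE.
    exists 0%N, u^-1; split; first exact: unitV.
    by rewrite expr0 mul1r -[z]invrK zE expr0 mul1r.
  case: nWp; have -> : p^-1 = p ^+ n * u * z.
    rewrite -[z]invrK zE exprS; field; rewrite p0 u0 expf_neq0 //.
  by do 2!apply: (subringM sW) => //; apply: (subringX sW).
split=> // I iI; case: (classic (exists2 w, I w & w != 0)) => [[w Iw w0]|no].
  have facI v : I v -> v != 0 -> exists n, I (p ^+ n) /\ exists2 u, W u & v = u * p ^+ n.
    move=> Iv v0; have [n [u [[u0 [Wu Wiu]] vE]]] := facW v (idealS iI Iv) v0.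
    exists n; split; last by exists u => //; rewrite mulrC.
    by have -> : p ^+ n = u^-1 * v; [rewrite vE; field | apply: (idealM iI)].
  have [n [In _]] := facI w Iw w0.
  have exn : exists n, asbool (I (p ^+ n)) by exists n; apply/asboolP.
  case: (ex_minnP exn) => k /asboolP Ik kmin.
  exists [:: p ^+ k]; split=> [[|j]//|v].
  split=> [Iv|[c [sc [Wc ->]]]]; last first.
    by rewrite big_ord1; apply: (idealM iI) => //; apply: Wc; rewrite sc.
  have [->|v0] := eqVneq v 0.
    exists [:: 0]; split=> //; split=> [[|j]//= _|]; first exact: subring0.
    by rewrite big_ord1 mul0r.
  have [l [Il [u Wu ->]]] := facI v Iv v0.
  have kl : (k <= l)%N by apply: kmin; apply/asboolP.
  exists [:: u * p ^+ (l - k)]; split=> //; split=> [[|j]//= _|].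
    by apply: (subringM sW) => //; apply: (subringX sW).
  by rewrite big_ord1 /= -mulrA -exprD subnK.
exists [::]; split=> // v; split=> [Iv|[c [_ [_ ->]]]]; last first.
  by rewrite big_ord0; apply: ideal0 iI.
exists [::]; split=> //; split=> //; rewrite big_ord0; apply/eqP.
by apply: contraT => v0; case: no; exists v.
Qed.

End UniformizerDvr.

Section NormalIntersection.
Variables (F : fieldType) (A : F -> Prop).
Hypotheses (nA : noetherian A) (cnA : completely_normal A) (qA : quotient_field A).
Let sA : subring A. Proof. by case: nA. Qed.

(* Q is an associated prime (L : c z) of the fractional ideal L + zL, and normality makes its
   localization a discrete valuation ring with uniformizer (c z)^-1. *)
Theorem localization_dvr_separation M z : mult_set A M -> ~ loc A M z ->
  exists W, dvr W /\ (forall y, loc A M y -> W y) /\ ~ W z.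
Proof.
move=> hM nLz; set L := loc A M; have sL : subring L by apply: loc_subring.
have AL y : A y -> L y by apply: loc_in.
pose D c t := A t /\ L (t * (c * z)).
have iD c : ideal A (D c).
  split=> [t []//|]; split; first by split; [|rewrite mul0r]; [apply: subring0 | apply: subring0].
  split=> [s t [As Ls] [At Lt]|a t Aa [At Lt]].
    by split; [apply: (subringD sA) | rewrite mulrDl; apply: (subringD sL)].
  by split; [apply: (subringM sA) | rewrite -mulrA; apply: (subringM sL) => //; apply: AL].
pose C I := exists c, A c /\ ~ L (c * z) /\ I = D c.
have [||Q [[c [Ac [nLcz QE]]] Qmax]] := @noetherian_maximal _ A C (D 1) nA.
- by exists 1; rewrite mul1r; split=> //; apply: subring1.
- by move=> I [c [_ [_ ->]]].
pose v := c * z; have iQ : ideal A Q by rewrite QE.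
have pQ : prime_ideal A Q.
  split=> //; split; first by rewrite QE => -[_]; rewrite mul1r.
  move=> s t As At Qst; case: (classic (Q s)) => [|nQs]; [by left | right].
  have nLs : ~ L (s * c * z) by move=> h; apply: nQs; rewrite QE; split=> //; rewrite mulrA.
  apply: (Qmax (D (s * c))).
  - by exists (s * c); split=> //; apply: (subringM sA).
  - move=> u; rewrite QE => -[Au Lu]; split=> //.
    have -> : u * (s * c * z) = s * (u * (c * z)) by ring.
    by apply: (subringM sL) => //; apply: AL.
  - split=> //; move: Qst; rewrite QE => -[_]; rewrite -!mulrA mulrCA.
    by rewrite mulrC -!mulrA; congr (L _); ring.
have hQ := prime_compl_mult_set sA pQ.
pose W := loc A (fun s => A s /\ ~ Q s); have sW : subring W by apply: loc_subring.
have AW y : A y -> W y by apply: loc_in.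
have WV s : A s -> ~ Q s -> W s^-1 by move=> As nQs; apply: loc_inv.
have LW y : L y -> W y.
  move=> [a [s [Aa [Ms ->]]]]; case: (hM) => _ [_ /(_ s Ms) [As s0]].
  apply: (subringM sW); first exact: AW.
  apply: WV => //; rewrite QE => -[_ h]; apply: nLcz.
  have -> : c * z = s^-1 * (s * (c * z)) by field.
  by apply: (subringM sL) => //; apply: loc_inv.
have QvW q : Q q -> W (q * v) by rewrite QE => -[_ /LW].
have nWv : ~ W v.
  move=> [a [s [Aa [[As nQs] vE]]]]; case: (hQ) => _ [_ /(_ s (conj As nQs)) [_ s0]].
  apply: nQs; rewrite QE; split=> //.
  by rewrite -/v vE mulrC divfK //; apply: AL.
have v0 : v != 0 by apply/eqP => v0; apply: nWv; rewrite v0; apply: subring0.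
exists W; split; last by split=> // Wz; apply: nWv; apply: (subringM sW) => //; apply: AW.
(* Some [q * v] with [q] in [Q] is a unit of [W]. Otherwise [Q v] lies in [Q W]; a common
   denominator [s] for finitely many generators gives [s v Q] inside [Q], so [s v] is in [A] by
   normality and [v] is in [W], a contradiction. *)
have [q [a [s [Qq [Aa [nQa [As [nQs qE]]]]]]]] : exists q a s,
    Q q /\ A a /\ ~ Q a /\ A s /\ ~ Q s /\ q * v = a / s.
  apply: NNPP => no.
  have QvQ q : Q q -> exists s, A s /\ ~ Q s /\ Q (s * (q * v)).
    move=> Qq; have [a [s [Aa [[As nQs] qE]]]] := QvW q Qq.
    exists s; split=> //; split=> //; case: (hQ) => _ [_ /(_ s (conj As nQs)) [_ s0]].
    rewrite qE mulrC divfK //; apply: NNPP => nQa; apply: no.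
    by exists q, a, s.
  case: (pQ) => _ [nQ1 pQ2].
  have [gs [gsQ gsP]] := (proj2 nA) _ iQ.
  have [s [As [nQs sP]]] : exists s, A s /\ ~ Q s /\
      forall j, (j < size gs)%N -> Q (s * (gs`_j * v)).
    elim: gs gsQ {gsP} => [|g gs IH] gsQ; first by exists 1; split=> //; apply: subring1.
    have [j js|s [As [nQs sP]]] := IH; first exact: (gsQ j.+1 js).
    have [s' [As' [nQs' s'P]]] := QvQ g (gsQ 0%N isT).
    exists (s * s'); split; first exact: (subringM sA).
    split; first by case/(pQ2 _ _ As As').
    move=> [|j] js /=; first by rewrite -mulrA; apply: (idealM iQ).
    by rewrite [s * s']mulrC -mulrA; apply: (idealM iQ) => //; apply: sP.
  have [a0 [b0 [Aa0 [Ab0 [b00 zE]]]]] := qA z.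
  have Qb0 : Q b0.
    rewrite QE; split=> //; apply: AL.
    have -> : b0 * (c * z) = c * a0 by rewrite zE; field.
    exact: (subringM sA).
  have Asv : A (s * v).
    apply: (cnA iQ Qb0 b00) => y /gsP [cs [scs [Acs ->]]]; rewrite mulr_sumr.
    apply: (ideal_sum iQ) => j _.
    have -> : s * v * (cs`_j * gs`_j) = cs`_j * (s * (gs`_j * v)) by ring.
    by apply: (idealM iQ); [apply: Acs; rewrite scs | apply: sP].
  case: (hQ) => _ [_ /(_ s (conj As nQs)) [_ s0]].
  by apply: nWv; exists (s * v), s; split=> //; split=> //; field.
have a0 : a != 0 by case: (hQ) => _ [_ /(_ a (conj Aa nQa)) []].
have s0 : s != 0 by case: (hQ) => _ [_ /(_ s (conj As nQs)) []].
have vVE : v^-1 = q * (s / a).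
  by rewrite -[q](mulfK v0) qE; field; rewrite v0 a0 s0.
have Ws : W (s / a) by apply: (subringM sW); [apply: AW | apply: WV].
have WvV : W v^-1 by rewrite vVE; apply: (subringM sW) => //; apply/AW/(idealS iQ).
have nonunit w : W w -> isunit W w \/ W (w * v).
  move=> [a' [s' [Aa' [[As' nQs'] ->]]]]; case: (classic (Q a')) => [Qa'|nQa'].
    by right; rewrite mulrAC; apply: (subringM sW); [apply: QvW | apply: WV].
  have a'0 : a' != 0 by case: (hQ) => _ [_ /(_ a' (conj Aa' nQa')) []].
  have s'0 : s' != 0 by case: (hQ) => _ [_ /(_ s' (conj As' nQs')) []].
  left; split; first by rewrite mulf_neq0 // invr_eq0.
  by rewrite invfM invrK; split; apply: (subringM sW); do ?[exact: AW | exact: WV].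
have facA w : A w -> w != 0 -> exists n u, isunit W u /\ w = v^-1 ^+ n * u.
  move=> Aw w0; apply: NNPP => no.
  have vn0 n : v ^+ n != 0 by rewrite expf_neq0.
  have Wn n : W (w * v ^+ n).
    elim: n => [|n IH]; first by rewrite mulr1; apply: AW.
    have [uw|] := nonunit _ IH; last by rewrite -mulrA -exprSr.
    by case: no; exists n, (w * v ^+ n); split=> //; rewrite mulrC exprVn mulfK.
  (* [E n] is the trace on [A] of [w v^n W], increasing because [v^-1] is in [W]. If [w v^n] is in
     [W] for every [n], stationarity of [E] puts [v] into [W]. *)
  pose E n t := A t /\ W (t / (w * v ^+ n)).
  have iE n : ideal A (E n).
    split=> [t []//|]; split; first by split; [|rewrite mul0r]; [apply: subring0 | apply: subring0].
    split=> [t t' [At Wt] [At' Wt']|b t Ab [At Wt]].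
      by split; [apply: (subringD sA) | rewrite mulrDl; apply: (subringD sW)].
    by split; [apply: (subringM sA) | rewrite -mulrA; apply: (subringM sW) => //; apply: AW].
  have [|n nP] := noetherian_acc nA iE.
    move=> n t [At Wt]; split=> //.
    have -> : t / (w * v ^+ n.+1) = v^-1 * (t / (w * v ^+ n)) by rewrite exprS; field; rewrite v0 w0 vn0.
    exact: (subringM sW).
  have [b [t [Ab [[At nQt] bE]]]] := Wn n.+1.
  have t0 : t != 0 by case: (hQ) => _ [_ /(_ t (conj At nQt)) []].
  have [_ h] : E n b.
    apply: (nP n.+1); split=> //.
    have -> : b / (w * v ^+ n.+1) = t.
      by rewrite -[b](divfK t0) -bE; field; rewrite w0 expf_neq0.
    exact: AW.
  apply: nWv; have -> : v = t^-1 * (b / (w * v ^+ n)).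
    by rewrite -[b](divfK t0) -bE exprS; field; rewrite w0 vn0 t0.
  by apply: (subringM sW) => //; apply: WV.
apply: (@uniformizer_dvr _ W v^-1) => //; first by rewrite invrK.
move=> y y0; have [b [t [Ab [At [t0 yE]]]]] := qA y.
have b0 : b != 0 by apply: contraNneq y0 => b0; rewrite yE b0 mul0r.
have [n [u [uu bE]]] := facA b Ab b0; have [k [u' [uu' tE]]] := facA t At t0.
have p0 : v^-1 != 0 by rewrite invr_eq0.
have u0 : u != 0 by case: uu.
have u'0 : u' != 0 by case: uu'.
have [kn|nk] := leqP k n.
  exists (n - k)%N, (u / u'); split; first by apply: unitM => //; apply: unitV.
  left; rewrite yE bE tE -{1}(subnK kn) exprD; field; rewrite u'0 expf_neq0 //.
exists (k - n)%N, (u' / u); split; first by apply: unitM => //; apply: unitV.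
right; rewrite yE bE tE invf_div -{1}(subnK (ltnW nk)) exprD; field; rewrite u0 expf_neq0 //.
Qed.

End NormalIntersection.

(** * Quadratic transforms *)

(** The last clause is analytic independence; it replaces every further reference to the
    dimension. *)
Definition regular_params (F : fieldType) (A : F -> Prop) d (x : 'I_d -> F) :=
  [/\ noetherian A, local A, generates A x & forall b, ~ Mgt A x b (mon x b)].

(** Exchange: as [t] is not in m^2, some coefficient [c k] of [t] in the given parameters is a unit,
    so [t] can replace [y k]. *)
Lemma regular_params_through (F : fieldType) (A : F -> Prop) d' t :
  regular_local A d'.+1 -> maxideal A t -> ~ idpow A (maxideal A) 2 t ->
  exists x : 'I_d'.+1 -> F, regular_params A x /\ x ord0 = t.
Proof.
move=> [nA [lA [[chn _] [s [ss [sm sP]]]]]] mt nt2; have sA : subring A by case: lA.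
case: (lA) => _ iM.
pose y (i : 'I_d'.+1) := s`_i.
have gy : generates A y.
  move=> z; split=> [/sP [c [sc [Ac ->]]]|[c [Ac ->]]].
    exists (fun i : 'I_d'.+1 => c`_i); split; last by rewrite ss.
    by move=> i; apply: Ac; rewrite sc ss.
  apply: (ideal_sum iM) => i _; apply: (idealM iM) => //.
  by apply: sm; rewrite ss.
have /gy [c [Ac tE]] := mt.
have [k uk] : exists k, isunit A (c k).
  apply: NNPP => no; apply: nt2; rewrite tE.
  apply: (ideal_sum (idpow_ideal sA iM 2)) => i _.
  have mc : maxideal A (c i).
    by have [u|//] := unit_or_max lA (Ac i); case: no; exists i.
  apply: idpowM => //; rewrite -[y i]mulr1; apply: idpowM; last exact: subring1.
  exact: generators_max.
(* [t] takes the place of [y k] and is then exchanged with the entry at position 0; for [k = ord0]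
   only the replacement remains. *)
pose x i := if i == ord0 then t else if i == k then y ord0 else y i.
have gx : generates A x.
  have mx i : maxideal A (x i).
    by rewrite /x; do 2!case: ifP => _ //; apply: generators_max.
  move=> z; split=> [/gy [e [Ae ->]]|[e [Ae ->]]]; last first.
    by apply: (ideal_sum iM) => i _; apply: (idealM iM).
  pose X z := exists e : 'I_d'.+1 -> F, (forall i, A (e i)) /\ z = \sum_i e i * x i.
  have XD u v : X u -> X v -> X (u + v).
    move=> [e1 [Ae1 ->]] [e2 [Ae2 ->]]; exists (fun i => e1 i + e2 i).
    by split=> [i|]; [apply: (subringD sA) | rewrite -big_split; apply: eq_bigr => i _; rewrite mulrDl].
  have XM a u : A a -> X u -> X (a * u).
    move=> Aa [e1 [Ae1 ->]]; exists (fun i => a * e1 i).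
    by split=> [i|]; [apply: (subringM sA) | rewrite mulr_sumr; apply: eq_bigr => i _; rewrite mulrA].
  have X0 : X 0 by exists (fun => 0); split=> [i|]; [apply: subring0 | rewrite big1 // => i _; rewrite mul0r].
  have Xx i : X (x i).
    exists (fun j => (j == i)%:R); split=> [j|].
      by case: eqP => _; [apply: subring1 | apply: subring0].
    by rewrite (bigD1 i) //= eqxx mul1r big1 ?addr0 // => j /negPf ->; rewrite mul0r.
  have Xyk i : i != k -> X (y i).
    move=> ik; have [i0|i0] := eqVneq i ord0; last by have := Xx i; rewrite /x (negPf i0) (negPf ik).
    by have := Xx k; rewrite /x eqxx i0; rewrite i0 eq_sym in ik; rewrite (negPf ik).
  have Xy i : X (y i).
    have [->|/Xyk//] := eqVneq i k.
    case: uk => ck0 [_ Aick].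
    have -> : y k = (c k)^-1 * (t + -1 * (\sum_(i | i != k) c i * y i)).
      by rewrite tE (bigD1 k) //= mulN1r addrK mulKf.
    apply: (XM) => //; apply: (XD); first by have := Xx ord0; rewrite /x eqxx.
    apply: (XM); first by apply: (subringN sA); apply: subring1.
    by apply: (big_ind X) => // j jk; apply: (XM) => //; apply: Xyk.
  by apply: (big_ind X) => // j _; apply: XM.
exists x; split; last by rewrite /x eqxx.
by split=> // b; apply: (analytic_independence nA lA gx chn).
Qed.

(** * The order valuation ring of a regular local ring *)

Section OrderValuationRing.
Variables (F : fieldType) (A : F -> Prop) (d : nat) (x : 'I_d -> F).
Hypothesis rx : regular_params A x.
Let nA : noetherian A. Proof. by case: rx. Qed.
Let lA : local A. Proof. by case: rx. Qed.
Let gx : generates A x. Proof. by case: rx. Qed.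
Let ix : forall b, ~ Mgt A x b (mon x b). Proof. by case: rx. Qed.
Let sA : subring A. Proof. by case: lA. Qed.
Let iP n : ideal A (idpow A (maxideal A) n). Proof. by case: lA => ? ?; apply: idpow_ideal. Qed.
Local Notation mp := (idpow A (maxideal A)).

Lemma idpow_mul n k a b : mp n a -> mp k b -> mp (n + k) (a * b).
Proof. by move=> /(idpowP lA gx) h /(idpowP lA gx) h'; apply/(idpowP lA gx); apply: mpowM. Qed.

Lemma idpow_le n k a : (n <= k)%N -> mp k a -> mp n a.
Proof. by move=> nk /(idpowP lA gx) h; apply/(idpowP lA gx); apply: mpow_le h. Qed.

Lemma has_order1 : has_order A 1 0.
Proof.
split; first exact: subring1.
by move=> /(idpowP lA gx) /(mpow1 lA gx); apply: max1.
Qed.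

Lemma has_orderX a n k : has_order A a n -> has_order A (a ^+ k) (n * k).
Proof.
move=> h; elim: k => [|k IH]; first by rewrite muln0; apply: has_order1.
by rewrite exprS mulnS; apply: (has_orderM nA lA gx ix).
Qed.

Lemma ord_valringP z : ord_valring A z <->
  exists a b k, mp k a /\ has_order A b k /\ z = a / b.
Proof.
split=> [[->|[a [b [Aa [Ab [b0 [zE ab]]]]]]]|[a [b [k [ak [hb zE]]]]]].
- exists 0, 1, 0%N; rewrite mul0r; split; first exact: subring0.
  by split=> //; apply: has_order1.
- have [k hk] := has_order_exists nA lA gx ix Ab b0.
  by exists a, b, k; split=> //; apply: ab; case: hk.
right; exists a, b; split; first exact: idealS (iP k) _ ak.
split; first exact: has_order_in hb.
split; first exact: has_order_neq0 hb.
split=> // n bn; apply: idpow_le ak; exact/(has_orderP lA gx _ hb).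
Qed.

Lemma ord_valring_subring : subring (ord_valring A).
Proof.
split; first by apply/ord_valringP; exists 1, 1, 0%N; rewrite divr1; split;
  [apply: subring1 | split=> //; apply: has_order1].
split=> z z' /ord_valringP [a [b [k [ak [hb ->]]]]] /ord_valringP [a' [b' [k' [ak' [hb' ->]]]]].
  have b0 := has_order_neq0 lA gx hb; have b'0 := has_order_neq0 lA gx hb'.
  apply/ord_valringP; exists (a * b' - b * a'), (b * b'), (k + k')%N.
  split; last by split; [apply: (has_orderM nA lA gx ix) | field; rewrite b'0 b0].
  case: hb hb' => hb _ [hb' _].
  by apply: (idealB (iP _) sA); apply: idpow_mul.
apply/ord_valringP; exists (a * a'), (b * b'), (k + k')%N; split; first exact: idpow_mul.
by split; [apply: (has_orderM nA lA gx ix) | rewrite invfM mulrACA].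
Qed.

Lemma ord_valring_order a b n k : has_order A a n -> has_order A b k ->
  ord_valring A (a / b) -> (k <= n)%N.
Proof.
move=> ha hb /ord_valringP [e [f [j [ej [hf abE]]]]].
have b0 := has_order_neq0 lA gx hb; have f0 := has_order_neq0 lA gx hf.
have afE : a * f = e * b by rewrite -[a](divfK b0) abE; field.
have /(has_orderP lA gx _ (has_orderM nA lA gx ix ha hf)) : mp (j + k) (a * f).
  by rewrite afE; apply: idpow_mul => //; case: hb.
by rewrite addnC leq_add2r.
Qed.

End OrderValuationRing.

Section QuadraticTransform.
Variables (F : fieldType) (A A' : F -> Prop) (d' : nat) (x : 'I_d'.+1 -> F).
Hypothesis rx : regular_params A x.
Let nA : noetherian A. Proof. by case: rx. Qed.
Let lA : local A. Proof. by case: rx. Qed.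
Let gx : generates A x. Proof. by case: rx. Qed.
Let ix : forall b, ~ Mgt A x b (mon x b). Proof. by case: rx. Qed.
Let sA : subring A. Proof. by case: lA. Qed.
Let iP n : ideal A (idpow A (maxideal A) n). Proof. by case: lA => ? ?; apply: idpow_ideal. Qed.
Local Notation mp := (idpow A (maxideal A)).
Local Notation x0 := (x ord0).
Local Notation B := (adjoin A (fun z => exists y, maxideal A y /\ z = y / x0)).
Hypothesis nx2 : ~ mp 2 x0.
Variable q : F -> Prop.
Hypotheses (pq : prime_ideal B q) (mq : forall y, maxideal A y -> q y).
Hypothesis A'P : forall z, A' z <-> exists b c, B b /\ B c /\ ~ q c /\ z = b / c.
Let iq : ideal B q. Proof. by case: pq. Qed.

Lemma center_order : has_order A x0 1.
Proof.
by split=> //; apply/(idpowP lA gx)/(mpow1 lA gx); apply: generators_max.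
Qed.
Let hx := center_order.

Lemma center_orderX n : has_order A (x0 ^+ n) n.
Proof. by have := has_orderX rx n hx; rewrite mul1n. Qed.

Lemma center_neq0 : x0 != 0. Proof. exact: has_order_neq0 hx. Qed.
Let x00 := center_neq0.
Let xn0 n : x0 ^+ n != 0. Proof. by rewrite expf_neq0. Qed.

Lemma adjoin_in z : A z -> B z. Proof. by move=> Az C sC AsubC _; apply: AsubC. Qed.

Lemma adjoin_frac y : maxideal A y -> B (y / x0).
Proof. by move=> my C sC AsubC GC; apply: GC; exists y. Qed.

Lemma adjoin_subring : subring B.
Proof.
split; first by apply: adjoin_in; apply: subring1.
by split=> y z By Bz C sC AsubC GC; [apply: (subringB sC) | apply: (subringM sC)];
  [apply: By | apply: Bz | apply: By | apply: Bz].
Qed.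
Let sB := adjoin_subring.

Lemma adjoinP z : B z <-> exists n a, mp n a /\ z = a / x0 ^+ n.
Proof.
split=> [Bz|[n [a [an ->]]]].
  apply: (Bz (fun z => exists n a, mp n a /\ z = a / x0 ^+ n)) => [|a Aa|_ [y [my ->]]];
    last 2 first.
  - by exists 0%N, a; rewrite expr0 divr1.
  - by exists 1%N, y; rewrite expr1; split=> //; apply/(idpowP lA gx)/(mpow1 lA gx).
  split; first by exists 0%N, 1; rewrite expr0 divr1; split=> //; apply: subring1.
  split=> u v [n [a [an ->]]] [k [b [bk ->]]].
    exists (n + k)%N, (a * x0 ^+ k - x0 ^+ n * b); split.
      apply: (idealB (iP _) sA); apply: (idpow_mul rx) => //.
        by case: (center_orderX k).
      by case: (center_orderX n).
    by rewrite exprD; field; rewrite !xn0.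
  exists (n + k)%N, (a * b); split; first exact: (idpow_mul rx).
  by rewrite exprD invfM mulrACA.
elim: n a an => [|n IH] a; first by move=> Aa; rewrite expr0 divr1; apply: adjoin_in.
move=> /idpowSP [ps [psP ->]]; rewrite big_seq mulr_suml; apply: (subring_sum sB) => p.
move=> /psP [mp1 /IH mp2]; rewrite exprS invfM mulrACA.
by apply: (subringM sB) => //; apply: adjoin_frac.
Qed.

Lemma adjoin_nq_neq0 c : ~ q c -> c != 0.
Proof. by move=> nqc; apply/eqP => c0; apply: nqc; rewrite c0; apply: ideal0 iq. Qed.

Lemma transform_adjoin z : B z -> A' z.
Proof.
move=> Bz; apply/A'P; exists z, 1; rewrite divr1; split=> //; split; first exact: (subring1 sB).
by split=> //; case: pq => _ [].
Qed.

Lemma transform_base z : A z -> A' z.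
Proof. by move=> Az; apply: transform_adjoin; apply: adjoin_in. Qed.

Lemma transform_div b c : B b -> B c -> ~ q c -> A' (b / c).
Proof. by move=> Bb Bc nqc; apply/A'P; exists b, c. Qed.

Lemma transform_frac y : maxideal A y -> A' (y / x0).
Proof. by move=> my; apply: transform_adjoin; apply: adjoin_frac. Qed.

Lemma transform_subring : subring A'.
Proof.
case: (pq) => _ [nq1 pq2]; split; first by apply: transform_base; apply: subring1.
split=> u v /A'P [b [c [Bb [Bc [nqc ->]]]]] /A'P [b' [c' [Bb' [Bc' [nqc' ->]]]]];
  have c0 := adjoin_nq_neq0 nqc; have c'0 := adjoin_nq_neq0 nqc';
  have nqcc : ~ q (c * c') by [case/(pq2 _ _ Bc Bc')].
  have -> : b / c - b' / c' = (b * c' - b' * c) / (c * c') by field; rewrite c'0 c0.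
  by apply: transform_div => //; [apply: (subringB sB)|]; apply: (subringM sB).
have -> : b / c * (b' / c') = (b * b') / (c * c') by field; rewrite c'0 c0.
by apply: transform_div => //; apply: (subringM sB).
Qed.

Lemma transform_unit c : B c -> ~ q c -> isunit A' c.
Proof.
move=> Bc nqc; split; first exact: adjoin_nq_neq0.
split; first exact: transform_adjoin.
by rewrite -div1r; apply: transform_div => //; apply: subring1.
Qed.

Lemma transform_max b : q b -> maxideal A' b.
Proof.
move=> qb; split; first by apply: transform_adjoin; apply: (idealS iq).
have [->|b0] := eqVneq b 0; first by left.
right=> /A'P [e [f [Be [Bf [nqf bE]]]]]; apply: nqf.
have f0 : f != 0.
  by apply: contraNneq b0 => f0; rewrite -invr_eq0 bE f0 invr0 mulr0.
have -> : f = e * b by rewrite -[e](divfK f0) -bE; field.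
exact: (idealM iq).
Qed.

Lemma transform_max_base y : maxideal A y -> maxideal A' y.
Proof. by move/mq/transform_max. Qed.

Lemma transform_maxP z : maxideal A' z ->
  exists b c, q b /\ B c /\ ~ q c /\ z = b / c.
Proof.
move=> [/A'P [b [c [Bb [Bc [nqc zE]]]]] nz]; exists b, c; do !split=> //.
case: nz => [z0|nz].
  suff -> : b = 0 by apply: ideal0 iq.
  by apply/eqP; move/eqP: z0; rewrite zE mulf_eq0 invr_eq0 (negPf (adjoin_nq_neq0 nqc)) orbF.
by apply: NNPP => nqb; apply: nz; rewrite zE invf_div; apply: transform_div.
Qed.

(** If [g] had order above [n], then [c] would be [g / x0 ^+ n.+1], an element of B, times [x0],
    hence in [q]. Denominators of [A'] therefore have value 0 for the order valuation, which puts
    [A'] inside its ring. *)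
Lemma adjoin_compl_order c : B c -> ~ q c ->
  exists n g, has_order A g n /\ c = g / x0 ^+ n.
Proof.
move=> /adjoinP [n [g [gn cE]]] nqc; exists n, g; split=> //; split=> // gn1; apply: nqc.
have -> : c = g / x0 ^+ n.+1 * x0 by rewrite cE exprS; field; rewrite x00 xn0.
by apply: (idealM iq); [apply/adjoinP; exists n.+1, g | apply/mq/generators_max].
Qed.

Lemma transform_ord_valring z : A' z -> ord_valring A z.
Proof.
move=> /A'P [b [c [/adjoinP [k [e [ek ->]]] [Bc [nqc ->]]]]].
have [n [g [hg ->]]] := adjoin_compl_order Bc nqc.
apply: (subringM (ord_valring_subring rx)).
  by apply/(ord_valringP rx); exists e, (x0 ^+ k), k; split=> //; split=> //; apply: center_orderX.
rewrite invf_div; apply/(ord_valringP rx); exists (x0 ^+ n), g, n.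
by split=> //; case: (center_orderX n).
Qed.

(** Says that [x0 V] and [A'] meet in [x0 A']. Write [b = x0 v c] as [g / x0 ^+ n] and [v c] as
    [e / f]; then [g f = x0 ^+ n.+1 e], and additivity of orders forces [g] into m^(n+1), so that
    [b / x0] is still in B. *)
Lemma transform_center_div v : A' (x0 * v) -> ord_valring A v -> A' v.
Proof.
move=> /A'P [b [c [Bb [Bc [nqc xvE]]]]] Vv; have c0 := adjoin_nq_neq0 nqc.
have := subringM (ord_valring_subring rx) Vv (transform_ord_valring (transform_adjoin Bc)).
move=> /(ord_valringP rx) [e [f [k [ek [hf vcE]]]]].
have f0 := has_order_neq0 lA gx hf.
have bE : b = x0 * (v * c) by rewrite mulrA xvE divfK.
have vE : v = b / x0 / c by rewrite bE; field; rewrite ?c0 ?x00.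
rewrite vE; apply: transform_div => //.
case/adjoinP: Bb => n [g [gn gE]]; rewrite gE.
have [->|g0] := eqVneq g 0; first by rewrite !mul0r; apply: subring0.
apply/adjoinP; exists n.+1, g; split; last by rewrite exprS; field; rewrite x00 xn0.
have [j hg] := has_order_exists nA lA gx ix (idealS (iP n) gn) g0.
apply/(has_orderP lA gx _ hg).
have /(has_orderP lA gx _ (has_orderM nA lA gx ix hg hf)) : mp (n.+1 + k) (g * f).
  have -> : g * f = x0 ^+ n.+1 * e.
    have -> : g = b * x0 ^+ n by rewrite gE divfK.
    rewrite bE vcE exprS; field; exact: f0.
  by apply: (idpow_mul rx) => //; case: (center_orderX n.+1).
by rewrite leq_add2r.
Qed.

Lemma transform_strict a r : mp r a -> A' (a / x0 ^+ r).
Proof. by move=> ar; apply: transform_adjoin; apply/adjoinP; exists r, a. Qed.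

(** The denominator [g] becomes a unit times a power of [x0]: once [x0] is inverted, [A'] is a
    localization of [A]. *)
Lemma transform_fraction z : A' z -> exists a g c n, A a /\ A g /\ isunit A' c /\
  g = c * x0 ^+ n /\ z = a / g.
Proof.
move=> /A'P [b [c [/adjoinP [k [e [ek ->]]] [Bc [nqc ->]]]]].
have uc := transform_unit Bc nqc.
have [n [g [hg cE]]] := adjoin_compl_order Bc nqc.
have g0 := has_order_neq0 lA gx hg.
have Ax0 : A x0 by apply: has_order_in hx.
exists (e * x0 ^+ n), (g * x0 ^+ k), c, (n + k)%N.
split; first by apply: (subringM sA); [apply: (idealS (iP k)) | apply: (subringX sA)].
split; first by apply: (subringM sA); [apply: has_order_in hg | apply: (subringX sA)].
split=> //; split; first by rewrite cE exprD; field; rewrite xn0.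
by rewrite cE; field; rewrite !xn0 g0.
Qed.

(** * The order of a strict transform, by Taylor expansion *)

Local Notation sA' := transform_subring.
Local Notation yhat := (fun i : 'I_d'.+1 => x i / x0).
Local Notation X0 := ('X_ord0 : {mpoly F[d'.+1]}).

Lemma yhat0 : yhat ord0 = 1. Proof. by rewrite /= divff. Qed.

Lemma yhat_in i : A' (yhat i).
Proof. by apply: transform_frac; apply: generators_max. Qed.

(** Taylor expansion at the point [yhat], whose coordinates are the generic coordinates of the
    center. All [d'.+1] homogeneous coordinates are kept, normalized by [yhat0], so that forms need
    not be dehomogenized. *)
Definition translate (g : {mpoly F[d'.+1]}) : {mpoly F[d'.+1]} :=
  g \mPo [tuple 'X_i + (yhat i)%:MP | i < d'.+1].

Lemma translateE g :
  translate g = \sum_(m <- msupp g) g@_m *: \prod_i ('X_i + (yhat i)%:MP) ^+ m i.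
Proof.
rewrite /translate comp_mpolyE; apply: eq_bigr => m _; congr (_ *: _).
by apply: eq_bigr => i _; rewrite tnth_mktuple.
Qed.

Lemma translateM g h : translate (g * h) = translate g * translate h.
Proof. exact: rmorphM. Qed.
Lemma translateD g h : translate (g + h) = translate g + translate h.
Proof. exact: comp_mpolyD. Qed.
Lemma translateB g h : translate (g - h) = translate g - translate h.
Proof. exact: comp_mpolyB. Qed.

Lemma translate0 g : (translate g)@_0 = g.@[yhat].
Proof.
rewrite translateE raddf_sum mevalE; apply: eq_bigr => m _ /=; rewrite mcoeffZ; congr (_ * _).
rewrite (rmorph_prod (mcoeff 0%MM)); apply: eq_bigr => i _; rewrite rmorphXn /=; congr (_ ^+ _).
by rewrite mcoeffD mcoeffX mcoeffC mnm1_eq0 eqxx add0r mulr1.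
Qed.

Lemma factor_in (m : 'X_{1..d'.+1}) :
  coefs_in A' (\prod_i ('X_i + (yhat i)%:MP) ^+ m i).
Proof.
apply: (coefs_in_prod sA') => i _; apply: (coefs_in_exp sA'); apply: (coefs_inD sA').
  exact: (coefs_inX sA').
by apply: (coefs_inC sA'); apply: yhat_in.
Qed.

Lemma translate_in g : coefs_in A g -> coefs_in A' (translate g).
Proof.
move=> Ag; rewrite translateE; apply: (coefs_in_sum sA') => m _.
by apply: (coefs_inZ sA'); [apply: transform_base | apply: factor_in].
Qed.

(** Translation is unitriangular for the monomial order: the translate of X^m has leading monomial
    X^m with coefficient 1. *)
Lemma factor_lead (m k : 'X_{1..d'.+1}) : (m <= k)%O ->
  (\prod_i ('X_i + (yhat i)%:MP) ^+ m i)@_k = (m == k)%:R.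
Proof.
have l1 (i : 'I_d'.+1) (c : F) : mlead ('X_i + c%:MP) = U_(i)%MM.
  by rewrite mleadDl mleadXm // mleadC lt_mdeg_ltmc // mdeg0 mdeg1.
have lc1 (i : 'I_d'.+1) (c : F) : ('X_i + c%:MP)@_(U_(i)) = 1.
  by rewrite mcoeffD mcoeffX mcoeffC mnm1_eq0 eqxx mulr0 addr0.
have n0 (i : 'I_d'.+1) (c : F) : 'X_i + c%:MP != 0 :> {mpoly F[d'.+1]}.
  by rewrite -mleadc_eq0 l1 lc1 oner_eq0.
set p := \prod_i _.
have lp : mlead p = m.
  rewrite /p mlead_prod => [|i _ _]; last by rewrite expf_neq0.
  rewrite [RHS]multinomUE_id; apply: eq_bigr => i _; rewrite mleadX // l1 //.
rewrite le_eqVlt => /orP [/eqP <-|mk]; last first.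
  by rewrite mcoeff_gt_mlead ?lp // lt_eqF.
rewrite eqxx -{1}lp /p mlead_prod => [|i _ _]; last by rewrite expf_neq0.
rewrite mleadc_prod big1 // => i _.
by rewrite mleadX // mleadcX l1 lc1 expr1n.
Qed.

(** Modulo the maximal ideal of [A'], the polynomial vanishes to order at least [n] at the
    origin. *)
Definition low n (p : {mpoly F[d'.+1]}) :=
  coefs_in A' p /\ forall m, (mdeg m < n)%N -> maxideal A' p@_m.

Hypothesis lA' : local A'.
Let iM' : ideal A' (maxideal A'). Proof. by case: lA'. Qed.

Lemma lowM n k p p' : low n p -> low k p' -> low (n + k) (p * p').
Proof.
move=> [Ap pn] [Ap' pk]; split; first exact: (coefs_inM sA').
move=> m mnk; rewrite mcoeffM; apply: (ideal_sum iM') => -[m1 m2] /= /eqP mE.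
have [m1n|nm1] := ltnP (mdeg m1) n.
  by rewrite mulrC; apply: (idealM iM') => //; apply: pn.
apply: (idealM iM') => //; apply: pk.
have mdE := congr1 (@mdeg _) mE; rewrite mdegD in mdE.
by rewrite -(ltn_add2l n) (leq_ltn_trans _ mnk) // [leqRHS]mdE leq_add2r.
Qed.

Lemma lowD n p p' : low n p -> low n p' -> low n (p + p').
Proof.
move=> [Ap pn] [Ap' pk]; split; first exact: (coefs_inD sA').
by move=> m mn; rewrite mcoeffD; apply: (idealD iM'); [apply: pn | apply: pk].
Qed.

Lemma low0 p : coefs_in A' p -> low 0 p. Proof. by split. Qed.

(** By [homog_eval] this means [z = g(x) / x0 ^+ e]. Degrees can be equalized with powers of [X0],
    whose value at [yhat] is 1. *)
Definition form_rep z (g : {mpoly F[d'.+1]}) e :=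
  [/\ coefs_in A g, g \is e.-homog & g.@[yhat] = z].

Lemma form_rep_adjoin z g e : form_rep z g e -> B z.
Proof.
move=> [Ag _ <-]; rewrite mevalE; apply: (subring_sum sB) => m _.
apply: (subringM sB); first exact: adjoin_in.
apply: (subring_prod sB) => i _; apply: (subringX sB); apply: adjoin_frac.
exact: generators_max.
Qed.

Lemma form_repM z w g h e k : form_rep z g e -> form_rep w h k ->
  form_rep (z * w) (g * h) (e + k).
Proof.
move=> [Ag hg <-] [Ah hh <-]; split; first exact: (coefs_inM sA).
  exact: dhomogM.
by rewrite mevalM.
Qed.

Lemma form_rep_pad z g e k : form_rep z g e -> form_rep z (g * X0 ^+ k) (e + k).
Proof.
move=> gz; rewrite -[z]mulr1; apply: form_repM => //; split.
- by apply: (coefs_in_exp sA); apply: (coefs_inX sA).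
- by rewrite -{2}[k]mul1n; apply: dhomogMn; rewrite dhomogX /= mdeg1.
- by rewrite rmorphXn /= mevalXU yhat0 expr1n.
Qed.

Lemma form_rep_padl z g e k : form_rep z g e -> form_rep z (g * X0 ^+ k) (k + e).
Proof. by rewrite addnC; apply: form_rep_pad. Qed.

Lemma form_repB z w g h e : form_rep z g e -> form_rep w h e -> form_rep (z - w) (g - h) e.
Proof.
move=> [Ag hg <-] [Ah hh <-]; split; first exact: (coefs_inB sA).
  by rewrite rpredB.
by rewrite mevalB.
Qed.

Lemma form_repD z w g h e : form_rep z g e -> form_rep w h e -> form_rep (z + w) (g + h) e.
Proof.
move=> [Ag hg <-] [Ah hh <-]; split; first exact: (coefs_inD sA).
  by rewrite rpredD.
by rewrite mevalD.
Qed.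

Lemma max_linear_form y : maxideal A y -> exists g : {mpoly F[d'.+1]},
  [/\ coefs_in A g, g \is 1.-homog & g.@[x] = y].
Proof.
move=> /gx [c [Ac ->]]; exists (\sum_i c i *: 'X_i); split.
- by apply: (coefs_in_sum sA) => i _; apply: (coefs_inZ sA) => //; apply: (coefs_inX sA).
- by apply: rpred_sum => i _; apply: rpredZ; rewrite dhomogX /= mdeg1.
- by rewrite raddf_sum; apply: eq_bigr => i _; rewrite /= mevalZ mevalXU.
Qed.

Lemma homog_eval g n : g \is n.-homog -> g.@[x] = x0 ^+ n * g.@[yhat].
Proof.
move=> /dhomogP gh; rewrite !mevalE mulr_sumr !big_seq; apply: eq_bigr => m /gh /= mn.
rewrite mulrCA -mn mdegE -prodrXr -big_split /=; congr (_ * _); apply: eq_bigr => i _.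
by rewrite -exprMn mulrC divfK.
Qed.

Lemma adjoin_form z : B z -> exists g e, form_rep z g e.
Proof.
move=> Bz; apply: (Bz (fun z => exists g e, form_rep z g e)) => [|a Aa|_ [y [my ->]]].
- split.
    exists 1, 0%N; split; [|exact: dhomog1|exact: meval1].
    by rewrite -mpolyC1; apply: (coefs_inC sA); apply: subring1.
  split=> u v [g [e ge]] [h [k hk]]; last by exists (g * h), (e + k)%N; apply: form_repM.
  exists (g * X0 ^+ k - h * X0 ^+ e), (e + k)%N; apply: form_repB; first exact: form_rep_pad.
  exact: form_rep_padl.
- exists a%:MP, 0%N; split; [exact: (coefs_inC sA)| |exact: mevalC].
  by rewrite -[a%:MP]mulr1 mul_mpolyC; apply: dhomogZ; apply: dhomog1.
- have [g [Ag hg <-]] := max_linear_form my; exists g, 1%N; split=> //.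
  by rewrite (homog_eval hg) expr1 mulrAC divff ?mul1r.
Qed.

Lemma idpow_form n z : mp n z -> exists g : {mpoly F[d'.+1]},
  [/\ coefs_in A g, g \is n.-homog & g.@[x] = z].
Proof.
elim: n z => [|n IH] z.
  move=> Az; exists z%:MP; split; [exact: (coefs_inC sA)| |exact: mevalC].
  by rewrite -[z%:MP]mulr1 mul_mpolyC; apply: dhomogZ; apply: dhomog1.
move=> /idpowSP [ps [psP ->]]; rewrite big_seq.
apply: (big_ind (fun z => exists g : {mpoly F[d'.+1]},
    [/\ coefs_in A g, g \is n.+1.-homog & g.@[x] = z])).
- exists 0; split; [|exact: rpred0|exact: meval0].
  by move=> m; rewrite mcoeff0; apply: subring0.
- move=> u v [g [Ag hg <-]] [h [Ah hh <-]]; exists (g + h); rewrite mevalD.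
  by split=> //; [apply: (coefs_inD sA) | rewrite rpredD].
- move=> p /psP [/max_linear_form [g [Ag hg <-]] /IH [h [Ah hh <-]]].
  exists (g * h); rewrite mevalM; split=> //; first exact: (coefs_inM sA).
  exact: (dhomogM (d := 1)) hg hh.
Qed.

(** Otherwise take the first unit coefficient, at [m]. The terms below it have coefficients in the
    maximal ideal and fall into degree [n + 1], the others lie in [Mgt m]; so x^m would be in
    [Mgt m], against analytic independence. *)
Lemma homog_zero_coefs h n : coefs_in A h -> h \is n.-homog -> h.@[x] = 0 ->
  forall m, maxideal A h@_m.
Proof.
move=> Ah /dhomogP hh hx0; elim/(well_founded_ind (@ltom_wf d'.+1)) => m IH.
have [u|//] := unit_or_max lA (Ah m).
case: (ix (b := m)); case: (u) => u0 [Au Aiu].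
have mh : m \in msupp h by rewrite mcoeff_msupp.
have iS Q : ideal A (monspan A x Q) by apply: monspan_ideal => //; apply: generators_in.
have rest : Mgt A x m (h.@[x] - h@_m * mon x m).
  rewrite mevalE_mon (bigD1_seq m) ?msupp_uniq //= addrAC subrr add0r.
  rewrite big_seq_cond; apply: (ideal_sum (iS _)) => k /andP [kh km].
  have dk : mdeg k = mdeg m by rewrite (hh _ kh) (hh _ mh).
  have [lt_km|mk] := ltP k m.
    apply: (@mpow_Mgt _ _ _ _ (1 + mdeg k)); first by rewrite dk.
    apply: mpowM => //; first by apply/(mpow1 lA gx); apply: IH.
    exact: monspan_mon1.
  by apply: monspan_mon => //; rewrite lt_neqAle eq_sym km.
have -> : mon x m = - (h@_m)^-1 * (h.@[x] - h@_m * mon x m) by rewrite hx0; field.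
by apply: (idealM (iS _)) => //; apply: (subringN sA).
Qed.

(** Contains the n-th power of the maximal ideal of [A'] ([frac_low_idpow]) but is expressed by
    forms over [A], where analytic independence can be applied. The element [w] outside [q] is the
    denominator, itself represented by the form [s]. *)
Definition frac_low n z := exists g s e k w,
  form_rep (z * w) g e /\ form_rep w s k /\ ~ q w /\ low n (translate g).

Lemma frac_low_max z : maxideal A' z -> frac_low 1 z.
Proof.
move=> /transform_maxP [b [c [qb [Bc [nqc zE]]]]]; have c0 := adjoin_nq_neq0 nqc.
have [g [e ge]] := adjoin_form (idealS iq qb); have [s [k sk]] := adjoin_form Bc.
exists g, s, e, k, c; rewrite zE divfK //; split=> //; split=> //; split=> //.
case: ge => Ag _ gb; split; first exact: translate_in.
move=> m; rewrite ltnS leqn0 mdeg_eq0 => /eqP ->.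
by rewrite translate0 gb; apply: transform_max.
Qed.

Lemma frac_low_in z : A' z -> frac_low 0 z.
Proof.
move=> /A'P [b [c [Bb [Bc [nqc zE]]]]]; have c0 := adjoin_nq_neq0 nqc.
have [g [e ge]] := adjoin_form Bb; have [s [k sk]] := adjoin_form Bc.
exists g, s, e, k, c; rewrite zE divfK //; split=> //; split=> //; split=> //.
by case: ge => Ag _ gb; apply: low0; apply: translate_in.
Qed.

Lemma frac_lowM n k z w : frac_low n z -> frac_low k w -> frac_low (n + k) (z * w).
Proof.
move=> [g [s [e [l [a [ga [sa [nqa la]]]]]]]] [g' [s' [e' [l' [a' [ga' [sa' [nqa' la']]]]]]]].
exists (g * g'), (s * s'), (e + e')%N, (l + l')%N, (a * a').
rewrite mulrACA translateM; split; first exact: form_repM.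
split; first exact: form_repM.
split; last exact: lowM.
by case: pq => _ [_ pq2] /pq2 [||//|//]; [apply: form_rep_adjoin sa | apply: form_rep_adjoin sa'].
Qed.

Lemma frac_lowD n z w : frac_low n z -> frac_low n w -> frac_low n (z + w).
Proof.
move=> [g [s [e [l [a [ga [sa [nqa la]]]]]]]] [g' [s' [e' [l' [a' [ga' [sa' [nqa' la']]]]]]]].
have lowin t k : coefs_in A t -> low 0 (translate (t * X0 ^+ k)).
  move=> At; apply: low0; apply: translate_in; apply: (coefs_inM sA) => //.
  by apply: (coefs_in_exp sA); apply: (coefs_inX sA).
exists (g * s' * X0 ^+ (e' + l) + g' * s * X0 ^+ (e + l')), (s * s').
exists (e + l' + (e' + l))%N, (l + l')%N, (a * a'); split.
  have -> : (z + w) * (a * a') = z * a * a' + w * a' * a by ring.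
  apply: form_repD; first by apply: form_rep_pad; apply: form_repM.
  by apply: form_rep_padl; apply: form_repM.
split; first exact: form_repM.
split; first by case: pq => _ [_ pq2] /pq2 [||//|//]; [apply: form_rep_adjoin sa | apply: form_rep_adjoin sa'].
rewrite translateD -!mulrA !(translateM g) !(translateM g'); apply: lowD.
  by rewrite -[n]addn0; apply: lowM => //; apply: lowin; case: sa'.
by rewrite -[n]addn0; apply: lowM => //; apply: lowin; case: sa.
Qed.

Lemma frac_low_idpow n z : idpow A' (maxideal A') n z -> frac_low n z.
Proof.
elim: n z => [|n IH] z; first exact: frac_low_in.
move=> /idpowSP [ps [psP ->]]; rewrite big_seq; apply: big_ind.
- rewrite -[0](mulr0 (0 : F)); apply: (@frac_lowM 1 n); first exact/frac_low_max/(ideal0 iM').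
  by apply: IH; apply: ideal0 (idpow_ideal sA' iM' n).
- exact: frac_lowD.
- by move=> p /psP [/frac_low_max h /IH h']; apply: (@frac_lowM 1 n).
Qed.

(* A form f of degree r over A with a unit coefficient stays nonzero modulo the maximal ideal
   after the translation by yhat, and its translate has degree at most r. *)
Lemma strict_transform_order a r : has_order A a r ->
  ~ idpow A' (maxideal A') r.+1 (a / x0 ^+ r).
Proof.
move=> [ar nar] /frac_low_idpow [g [s [e [k [w [gw [sw [nqw lg]]]]]]]].
have [f [Af hf fa]] := idpow_form ar.
have fr : form_rep (a / x0 ^+ r) f r.
  by split=> //; rewrite -fa (homog_eval hf) mulrAC divff ?mul1r.
have [m0 nm0] : exists m, ~ maxideal A f@_m.
  apply: NNPP => no; apply: nar; apply/(idpowP lA gx); rewrite -fa mevalE_mon big_seq.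
  apply: (ideal_sum (mpow_ideal lA gx _)) => m mf.
  apply: (@mpowM _ _ _ _ lA 1 r) => //; first by apply/(mpow1 lA gx); apply: NNPP => h; apply: no; exists m.
  by apply: monspan_mon1 => //; rewrite (dhomog_mf hf mf).
have mf m : ~ maxideal A f@_m -> (mdeg m < r.+1)%N.
  move=> nm; rewrite (dhomog_mf hf) // mcoeff_msupp; apply/eqP => f0; apply: nm.
  by rewrite f0; case: lA => _ iM; apply: ideal0 iM.
(* The largest exponent with unit coefficient. Translation is unitriangular and the coefficients at
   larger exponents are in the maximal ideal, so the coefficient at [t] remains a unit after
   translation. *)
have [t [tr nt above]] : exists t : 'X_{1..d'.+1}, [/\ (mdeg t < r.+1)%N,
    ~ maxideal A f@_t & forall m : 'X_{1..d'.+1}, (t < m)%O -> maxideal A f@_m].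
  pose P (m : 'X_{1..d'.+1 < r.+1}) := asbool (~ maxideal A f@_m).
  have P0 : P (BMultinom (mf m0 nm0)) by apply/asboolP.
  have [t /asboolP nt tmax] :=
    arg_maxP (fun b : 'X_{1..d'.+1 < r.+1} => (b : 'X_{1..d'.+1})) P0.
  exists t; split=> // [|m tm]; first exact: bmdeg.
  apply: NNPP => nm; have /tmax /= : P (BMultinom (mf m nm)) by apply/asboolP.
  by rewrite leNgt tm.
have nTf : ~ maxideal A' (translate f)@_t.
  move=> Tft; suff h : maxideal A' f@_t.
    have [u|//] := unit_or_max lA (Af t); apply: (@unit_not_max _ A' _ _ h).
    by case: u => u0 [Au Aiu]; split=> //; split; apply: transform_base.
  have tf : t \in msupp f.
    rewrite mcoeff_msupp; apply/eqP => f0; apply: nt; rewrite f0.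
    by case: lA => _ iM; apply: ideal0 iM.
  move: Tft; rewrite translateE raddf_sum (bigD1_seq t) ?msupp_uniq //=.
  rewrite mcoeffZ factor_lead // eqxx mulr1 => Tft.
  set R := \sum_(_ <- _ | _) _ in Tft.
  have mR : maxideal A' R.
    rewrite /R big_seq_cond; apply: (ideal_sum iM') => m /andP [mfm mt]; rewrite mcoeffZ.
    have [lt_mt|tm] := ltP m t.
      by rewrite (factor_lead (ltW lt_mt)) (negPf mt) mulr0; apply: ideal0 iM'.
    rewrite mulrC; apply: (idealM iM'); first exact: factor_in.
    by apply: transform_max_base; apply: above; rewrite lt_neqAle eq_sym mt.
  by rewrite -(addrK R f@_t); apply: (idealB iM' sA').
(* Two forms of the same degree with the same value [w * (a / x0 ^+ r)] at [yhat]: analytic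
   independence makes them congruent modulo the maximal ideal. *)
have [Ah hh he] := form_repB (form_rep_pad e (form_repM sw fr)) (form_rep_padl (k + r) gw).
have hx0 : (s * f * X0 ^+ e - g * X0 ^+ (k + r)).@[x] = 0.
  by rewrite (homog_eval hh) he mulrC [_ * w]mulrC subrr mul0r.
have hm := homog_zero_coefs Ah hh hx0.
pose S := translate s * translate (X0 ^+ e).
have AX j : coefs_in A (X0 ^+ j) by apply: (coefs_in_exp sA); apply: (coefs_inX sA).
have AS : coefs_in A' S.
  by apply: (coefs_inM sA'); apply: translate_in => //; case: sw.
have S0 : ~ maxideal A' S@_0.
  rewrite /S -translateM translate0; have [_ _ ->] := form_rep_pad e sw.
  apply: unit_not_max; apply: transform_unit => //.
  exact: form_rep_adjoin sw.
have lowS : low r.+1 (S * translate f).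
  have -> : S * translate f = translate (s * f * X0 ^+ e - g * X0 ^+ (k + r)) +
      translate g * translate (X0 ^+ (k + r)).
    by rewrite translateB !translateM /S; ring.
  apply: lowD; last first.
    by rewrite -[r.+1]addn0; apply: lowM => //; apply: low0; apply: translate_in.
  split; first exact: translate_in.
  move=> m _; rewrite translateE raddf_sum; apply: (ideal_sum iM') => j _ /=.
  rewrite mcoeffZ mulrC; apply: (idealM iM'); first exact: factor_in.
  by apply: transform_max_base; apply: hm.
(* [S] has a unit constant term, so by induction along the monomial order the coefficients of
   [translate f] in degrees up to [r] inherit membership in the maximal ideal from
   [S * translate f]. This includes the one at [t]. *)
apply: nTf; move: tr; elim/(well_founded_ind (@ltom_wf d'.+1)): t {nt above} => m IH mr.
have ATf : coefs_in A' (translate f) by apply: translate_in.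
have [_ /(_ m mr)] := lowS; rewrite mcoeffM.
have bm : (mdeg m < (mdeg m).+1)%N by [].
rewrite (bigD1 (bm0, BMultinom bm)) /= ?add0m // => hsum.
set R := \sum_(_ | _) _ in hsum.
have mR : maxideal A' R.
  apply: (ideal_sum iM') => -[m1 m2] /= /andP [/eqP mE neq].
  apply: (idealM iM') => //; apply: IH.
    suff : ((m2 : 'X_{1..d'.+1}) < (m1 + m2)%MM)%O by rewrite -mE.
    have m10 : (m1 : 'X_{1..d'.+1}) != 0%MM.
      apply: contra neq => /eqP m10; rewrite eqE /= !bmeqP /= m10 eqxx /=.
      by apply/eqP; rewrite [RHS]mE m10 add0m.
    rewrite -{1}[(m2 : 'X_{1..d'.+1})]add0m ltmc_add2l lt_neqAle eq_sym m10.
    exact: le0m.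
  by apply: leq_ltn_trans mr; rewrite [leqRHS](congr1 (@mdeg _) mE) mdegD leq_addl.
have [_ [_ pm']] := maxideal_prime lA'.
have hp : maxideal A' (S@_0 * (translate f)@_m).
  by rewrite -(addrK R (_ * _)); apply: (idealB iM' sA').
by case: (pm' _ _ (AS _) (ATf _) hp).
Qed.

End QuadraticTransform.

(** * Infinite sequences of quadratic transforms *)

Definition blowup (F : fieldType) (A A' : F -> Prop) t :=
  exists d' (x : 'I_d'.+1 -> F) q, [/\ regular_params A x, x ord0 = t,
    ~ idpow A (maxideal A) 2 t, local A' &
    let B := adjoin A (fun z => exists y, maxideal A y /\ z = y / t) in
    [/\ prime_ideal B q, forall y, maxideal A y -> q y &
      forall z, A' z <-> exists b c, B b /\ B c /\ ~ q c /\ z = b / c]].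

Lemma quadratic_transform_blowup (F : fieldType) (A A' : F -> Prop) d :
  (0 < d)%N -> regular_local A d -> local A' -> quadratic_transform A A' ->
  exists t, blowup A A' t.
Proof.
case: d => // d' _ rA lA' [t [mt [nt2 [q [pq [mq A'P]]]]]].
have [x [rx xt]] := regular_params_through rA mt nt2.
by exists t, d', x, q.
Qed.

Section BlowupSequence.
Variables (F : fieldType) (R : nat -> F -> Prop) (t : nat -> F).
Hypothesis bl : forall i, blowup (R i) (R i.+1) (t i).
Local Notation V i := (ord_valring (R i)).
Local Notation mm i := (maxideal (R i)).
Implicit Types (i j h k n r : nat) (z a b s : F).

Lemma seq_local i : local (R i).
Proof. by case: (bl i) => d [x [q [[]]]]. Qed.
Lemma seq_noetherian i : noetherian (R i).
Proof. by case: (bl i) => d [x [q [[]]]]. Qed.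
Let sR i : subring (R i). Proof. by case: (seq_local i). Qed.

Lemma seq_normal i : completely_normal (R i).
Proof. by case: (bl i) => d [x [q [[nA lA gx ix] *]]]; apply: regular_completely_normal ix. Qed.

Lemma seq_center i : mm i (t i).
Proof. by case: (bl i) => d [x [q [[nA lA gx ix] <- *]]]; apply: generators_max. Qed.

Lemma seq_center_neq0 i : t i != 0.
Proof. by case: (bl i) => d [x [q [rx <- nx2 *]]]; apply: (center_neq0 rx). Qed.
Let t0 := seq_center_neq0.
Let tX0 i n : t i ^+ n != 0. Proof. by rewrite expf_neq0. Qed.

Lemma seq_frac i y : mm i y -> R i.+1 (y / t i).
Proof.
case: (bl i) => d [x [q [rx <- nx2 lA' [pq mq A'P]]]] my.
exact: (transform_frac rx pq A'P).
Qed.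

Lemma seq_sub1 i z : R i z -> R i.+1 z.
Proof.
case: (bl i) => d [x [q [rx xt nx2 lA' [pq mq A'P]]]] Rz.
by rewrite -xt in pq A'P; apply: (transform_base rx pq A'P).
Qed.

Lemma seq_max1 i y : mm i y -> mm i.+1 y.
Proof.
case: (bl i) => d [x [q [rx xt nx2 lA' [pq mq A'P]]]] my.
by rewrite -xt in nx2 pq A'P; apply: (transform_max_base rx pq mq A'P).
Qed.

Lemma seq_valring i z : R i.+1 z -> V i z.
Proof.
case: (bl i) => d [x [q [rx xt nx2 lA' [pq mq A'P]]]].
by rewrite -xt in nx2 pq A'P; apply: (transform_ord_valring rx nx2 pq mq A'P).
Qed.

Lemma seq_center_div i v : R i.+1 (t i * v) -> V i v -> R i.+1 v.
Proof.
case: (bl i) => d [x [q [rx <- nx2 lA' [pq mq A'P]]]].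
exact: (transform_center_div rx nx2 pq mq A'P).
Qed.

Lemma seq_strict i a r : idpow (R i) (mm i) r a -> R i.+1 (a / t i ^+ r).
Proof.
case: (bl i) => d [x [q [rx <- nx2 lA' [pq mq A'P]]]].
exact: (transform_strict rx nx2 pq A'P).
Qed.

Lemma seq_strict_order i a r : has_order (R i) a r ->
  ~ idpow (R i.+1) (mm i.+1) r.+1 (a / t i ^+ r).
Proof.
case: (bl i) => d [x [q [rx <- nx2 lA' [pq mq A'P]]]].
exact: (strict_transform_order rx nx2 pq mq A'P).
Qed.

Lemma seq_fraction i z : R i.+1 z -> exists a g c n, R i a /\ R i g /\ isunit (R i.+1) c /\
  g = c * t i ^+ n /\ z = a / g.
Proof.
case: (bl i) => d [x [q [rx <- nx2 lA' [pq mq A'P]]]].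
exact: (transform_fraction rx nx2 pq mq A'P).
Qed.

Lemma seq_valring_subring i : subring (V i).
Proof. by case: (bl i) => d [x [q [rx *]]]; apply: ord_valring_subring rx. Qed.

Lemma seq_order_exists i a : R i a -> a != 0 -> exists n, has_order (R i) a n.
Proof. by case: (bl i) => d [x [q [[nA lA gx ix] *]]]; apply: (has_order_exists nA lA gx ix). Qed.

Lemma seq_orderP i a n k : has_order (R i) a n -> idpow (R i) (mm i) k a <-> (k <= n)%N.
Proof.
move=> ha; case: (bl i) => d [x [q [[nA lA gx ix] *]]]; exact: (has_orderP lA gx k ha).
Qed.

Lemma seq_order_neq0 i a n : has_order (R i) a n -> a != 0.
Proof.
move=> ha; case: (bl i) => d [x [q [[nA lA gx ix] *]]]; exact: (has_order_neq0 lA gx ha).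
Qed.

Lemma seq_valring_order i a b n k : has_order (R i) a n -> has_order (R i) b k ->
  V i (a / b) <-> (k <= n)%N.
Proof.
move=> ha hb; case: (bl i) => d [x [q [rx _ _ _ _]]].
split; first exact: (ord_valring_order rx ha hb).
move=> kn; apply/(ord_valringP rx); exists a, b, k; split=> //.
exact/(seq_orderP k ha).
Qed.

Lemma seq_sub i j z : (i <= j)%N -> R i z -> R j z.
Proof.
move=> ij Rz; rewrite -(subnK ij); elim: (j - i)%N => // n IH.
by rewrite addSn; apply: seq_sub1.
Qed.

Lemma seq_max i j z : (i <= j)%N -> mm i z -> mm j z.
Proof.
move=> ij Rz; rewrite -(subnK ij); elim: (j - i)%N => // n IH.
by rewrite addSn; apply: seq_max1.
Qed.

Lemma seq_in_valring i z : R i z -> V i z.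
Proof. by move/seq_sub1/seq_valring. Qed.

(** Inverting [t i] also inverts every later [t l]: as [t i] is in the maximal ideal of [R l], the
    quotient [t i / t l] lies in [R l.+1]. This is the factor in the witness for [e] that absorbs
    the power of [t l] in the denominator. *)
Lemma seq_localization i j z : (i <= j)%N -> R j z -> exists a s e k,
  [/\ R i a, R i s, R j e, s * e = t i ^+ k & z = a / s].
Proof.
move=> ij; rewrite -(subnK ij); elim: (j - i)%N z => [|n IH] z.
  move=> Rz; exists z, 1, 1, 0%N; rewrite divr1 mulr1 expr0.
  by split=> //; apply: subring1.
rewrite addSn; set l := (n + i)%N => /seq_fraction [a [g [c [m [Ra [Rg [[c0 [_ Rc]] [gE zE]]]]]]]].
have [a1 [s1 [e1 [k1 [Ra1 Rs1 Re1 se1 aE]]]]] := IH a Ra.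
have [a2 [s2 [e2 [k2 [Ra2 Rs2 Re2 se2 gE2]]]]] := IH g Rg.
have s10 : s1 != 0 by apply: contraNneq (tX0 i k1); rewrite -se1 => ->; rewrite mul0r.
have s20 : s2 != 0 by apply: contraNneq (tX0 i k2); rewrite -se2 => ->; rewrite mul0r.
have a2E : a2 = c * t l ^+ m * s2 by rewrite -gE gE2 divfK.
exists (a1 * s2), (s1 * a2), (e1 * e2 * c^-1 * (t i / t l) ^+ m), (k1 + k2 + m)%N; split.
- exact: (subringM (sR i)).
- exact: (subringM (sR i)).
- apply: (subringM (sR _)); last first.
    by apply: (subringX (sR _)); apply: seq_frac; apply: seq_max (seq_center i); apply: leq_addl.
  by do 2![apply: (subringM (sR _)) => //]; apply: seq_sub1.
- rewrite a2E !exprD -se1 -se2 expr_div_n; field; rewrite c0 ?tX0 //.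
- rewrite zE gE2 aE; have [a20|a20] := eqVneq a2 0; first by rewrite a20 !(mulr0, mul0r, invr0).
  by field; rewrite ?s10 ?s20 ?a20.
Qed.

(** The elements of [R i] that are units in S[1/t_i]; the localization of [R i] at them is
    S[1/t_i]. *)
Definition center_divisors i s := R i s /\ exists j e k, [/\ (i <= j)%N, R j e & s * e = t i ^+ k].

Lemma center_divisors_mult_set i : mult_set (R i) (center_divisors i).
Proof.
split; first by split; [apply: subring1 | exists i, 1, 0%N; rewrite mulr1 expr0; split=> //; apply: subring1].
split=> [s s' [Rs [j [e [k [ij Re se]]]]] [Rs' [j' [e' [k' [ij' Re' se']]]]]|s [Rs [j [e [k [_ _ se]]]]]].
  split; first exact: (subringM (sR i)).
  exists (maxn j j'), (e * e'), (k + k')%N; split.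
  - by rewrite leq_max ij.
  - by apply: (subringM (sR _)); [apply: seq_sub Re | apply: seq_sub Re']; rewrite leq_max leqnn ?orbT.
  - by rewrite mulrACA se se' exprD.
by split=> //; apply: contraNneq (tX0 i k); rewrite -se => ->; rewrite mul0r.
Qed.

Hypothesis qR : quotient_field (R 0%N).

Lemma seq_quotient_field i : quotient_field (R i).
Proof.
by move=> z; have [a [b [Ra [Rb h]]]] := qR z; exists a, b; split; [|split]; try exact: seq_sub Ra;
  try exact: seq_sub Rb.
Qed.

Lemma hull_sub_localization i z : noetherian_hull (fun y => exists i, R i y) z ->
  exists j k, (i <= j)%N /\ R j (z * t i ^+ k).
Proof.
move=> Tz; have hM := center_divisors_mult_set i.
have [a [s [Ra [[Rs [j [e [k [ij Re se]]]]] zE]]]] : loc (R i) (center_divisors i) z.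
  apply: NNPP => nL.
  have [W [dW [LW nWz]]] :=
    localization_dvr_separation (seq_noetherian i) (@seq_normal i) (@seq_quotient_field i) hM nL.
  apply: nWz; apply: Tz => //; split=> [y [j Ry]|].
    apply: LW.
    have [||a [s [e [k [Ra Rs Re se yE]]]]] := @seq_localization i (maxn i j) y.
    - by rewrite leq_maxl.
    - by apply: seq_sub Ry; rewrite leq_maxr.
    exists a, s; split=> //; split=> //; split=> //.
    by exists (maxn i j), e, k; split=> //; rewrite leq_maxl.
  exists (t i)^-1; split.
    apply: LW; apply: (loc_inv (sR i) hM); split; first by case: (seq_center i).
    by exists i, 1, 1%N; rewrite mulr1; split=> //; apply: subring1.
  move=> [j Rj]; have [_] := seq_max (leq_maxl i j) (seq_center i).
  case=> [/eqP|]; first by rewrite (negPf (t0 i)).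
  by apply; apply: seq_sub Rj; rewrite leq_maxr.
exists j, k; split=> //; have s0 : s != 0 by case: hM => _ [_ /(_ s)]; case=> //; split=> //; exists j, e, k.
have -> : z * t i ^+ k = a * e by rewrite zE -se; field.
by apply: (subringM (sR j)) => //; apply: seq_sub Ra.
Qed.

(* E is an overring of R_{h+1} whose elements are fractions of R_{h+1} with denominators
   invertible in E: dividing by t h inside V h does not leave E. *)
Lemma cancel_center (E : F -> Prop) h z n :
  (forall y y', E y -> E y' -> E (y * y')) -> (forall y, R h.+1 y -> E y) ->
  (forall y, E y -> exists a s, [/\ R h.+1 a, R h.+1 s, s != 0, E s^-1 & y = a / s]) ->
  V h z -> E (z * t h ^+ n) -> E z.
Proof.
move=> EM RE Efrac Vz; have sV := seq_valring_subring h.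
elim: n => [|n IH]; first by rewrite expr0 mulr1.
move/Efrac => [a [s [Ra Rs s0 Es yE]]]; apply: IH.
have -> : z * t h ^+ n = (z * t h ^+ n * s) * s^-1 by rewrite mulfK.
apply: EM => //; apply: RE; apply: seq_center_div.
  have -> : t h * (z * t h ^+ n * s) = z * t h ^+ n.+1 * s by rewrite exprS; ring.
  by rewrite yE divfK.
apply: (subringM sV); last exact: seq_valring.
apply: (subringM sV) => //; apply: (subringX sV); apply: seq_in_valring.
by case: (seq_center h).
Qed.

(** [R l] lies in E = R_l[1/t_(i+1)], which satisfies the hypotheses of [cancel_center] by
    [seq_localization]. Cancelling [t i] there gives the same situation with [i.+1] in place of [i];
    for [i.+1 = l] the ring E is [R l] itself. *)
Lemma valring_descent i j k z : (i <= j)%N -> (forall h, (i <= h)%N -> V h z) ->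
  R j (z * t i ^+ k) -> exists j, R j z.
Proof.
(* The center [t h] is cancelled in overrings of [R h.+1], so [l] has to be strictly larger than
   [i], also when [j = i]. *)
move=> ij Vz Rj; pose l := j.+1.
have {Rj} : exists k, R l (z * t i ^+ k) by exists k; apply: seq_sub1.
have {ij} : (i < l)%N by [].
move: l => l; have [n] : exists n, (n = l - i)%N by eexists.
elim: n i Vz => [|n IH] i Vz nE il; first by move: il; rewrite -subn_gt0 -nE.
move=> [k' Rl]; have [lE|li] := eqVneq i.+1 l.
  exists l; rewrite -lE in Rl *; apply: (@cancel_center (R i.+1) i z k') => //.
  - exact: (subringM (sR _)).
  - move=> y Ry; exists y, 1; rewrite divr1 invr1 oner_eq0.
    by split=> //; apply: subring1.
  - exact: Vz.
have il1 : (i.+1 < l)%N by rewrite ltn_neqAle li.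
apply: (IH i.+1) => //; [by move=> h ih; apply: Vz; apply: ltnW | by rewrite subnS -nE |].
apply: (@cancel_center (fun y => exists k, R l (y * t i.+1 ^+ k)) i z k').
- move=> y y' [m Ry] [m' Ry']; exists (m + m')%N; rewrite exprD mulrACA.
  exact: (subringM (sR l)).
- by move=> y Ry; exists 0%N; rewrite mulr1; apply: seq_sub Ry.
- move=> y [m Ry].
  have [a [s [e [m' [Ra Rs Re se yE]]]]] := seq_localization (ltnW il1) Ry.
  have s0 : s != 0 by apply: contraNneq (tX0 i.+1 m'); rewrite -se => ->; rewrite mul0r.
  exists a, (s * t i.+1 ^+ m); split=> //.
  + apply: (subringM (sR _)) => //; apply: (subringX (sR _)).
    by case: (seq_center i.+1).
  + by rewrite mulf_neq0.
  + exists (m + m')%N; have -> : (s * t i.+1 ^+ m)^-1 * t i.+1 ^+ (m + m') = e => //.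
    by rewrite exprD -se; field; rewrite s0 tX0.
  + by rewrite -[y](mulfK (tX0 i.+1 m)) yE; field; rewrite s0 tX0.
- exact: Vz.
by exists 0%N; rewrite mulr1.
Qed.

(* The pair (a, b) with z = a / b is replaced by (a / t^r, b / t^r), r the smaller order;
   since orders of strict transforms do not grow, a globally minimal r is kept forever. *)
Lemma valring_eventually z : z != 0 -> (forall i0, exists i, (i0 <= i)%N /\ V i z) ->
  exists i, forall h, (i <= h)%N -> V h z.
Proof.
move=> z0 io.
pose rep i r := exists a b n k, [/\ has_order (R i) a n, has_order (R i) b k, z = a / b,
  (r <= n)%N /\ (r <= k)%N & n = r \/ k = r].
have [a [b [Ra [Rb [b0 zE]]]]] := qR z.
have a0 : a != 0 by apply: contraNneq z0 => a0; rewrite zE a0 mul0r.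
have [n ha] := seq_order_exists Ra a0; have [k hb] := seq_order_exists Rb b0.
have exr : exists r, asbool (exists i, rep i r).
  exists (minn n k); apply/asboolP; exists 0%N, a, b, n, k; split=> //.
    by rewrite geq_minl geq_minr.
  by case: (leqP n k) => h; [left | right].
case: (ex_minnP exr) => r /asboolP [i0 rep0] rmin.
(* An order equal to [r] cannot rise, by [seq_strict_order], nor fall, by minimality of [r].
   Whichever of numerator and denominator attains [r] goes on attaining it. *)
have step i a' b' n' k' : has_order (R i) a' n' -> has_order (R i) b' k' -> z = a' / b' ->
    (r <= n')%N -> (r <= k')%N -> (n' = r \/ k' = r) -> exists a1 b1 n1 k1,
    [/\ has_order (R i.+1) a1 n1, has_order (R i.+1) b1 k1, z = a1 / b1,
      (r <= n1)%N /\ (r <= k1)%N & (n' = r -> n1 = r) /\ (k' = r -> k1 = r)].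
  move=> ha' hb' zE' rn rk nk.
  have str c m : has_order (R i) c m -> (r <= m)%N -> exists m1,
      has_order (R i.+1) (c / t i ^+ r) m1 /\ (m = r -> (m1 <= r)%N).
    move=> hc rm.
    have [|m1 h1] := @seq_order_exists i.+1 (c / t i ^+ r) (seq_strict (proj2 (seq_orderP r hc) rm)).
      by rewrite mulf_neq0 ?invr_eq0 // (seq_order_neq0 hc).
    exists m1; split=> // mr; rewrite mr in hc.
    rewrite leqNgt; apply/negP => /(seq_orderP r.+1 h1); exact: seq_strict_order.
  have [n1 [h1 n1r]] := str _ _ ha' rn; have [k1 [h2 k1r]] := str _ _ hb' rk.
  have zE1 : z = a' / t i ^+ r / (b' / t i ^+ r).
    by rewrite zE'; field; rewrite tX0 (seq_order_neq0 hb').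
  have rle : (r <= minn n1 k1)%N.
    apply: rmin; apply/asboolP; exists i.+1, (a' / t i ^+ r), (b' / t i ^+ r), n1, k1.
    split=> //; first by rewrite geq_minl geq_minr.
    by case: (leqP n1 k1) => h; [left | right].
  move: rle; rewrite leq_min => /andP [rn1 rk1].
  exists (a' / t i ^+ r), (b' / t i ^+ r), n1, k1; split=> //; split=> h; apply/eqP;
    by rewrite eqn_leq ?rn1 ?rk1 ?n1r ?k1r.
have repS i : rep i r -> rep i.+1 r.
  move=> [a' [b' [n' [k' [ha' hb' zE' [rn rk] nk]]]]].
  have [a1 [b1 [n1 [k1 [? ? ? [? ?] [e1 e2]]]]]] := step _ _ _ _ _ ha' hb' zE' rn rk nk.
  by exists a1, b1, n1, k1; split=> //; case: nk => [/e1|/e2]; [left | right].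
have rep_ge i : (i0 <= i)%N -> rep i r.
  move=> h; rewrite -(subnK h); elim: (i - i0)%N => // m; rewrite addSn; exact: repS.
have [i [ii0 Vi]] := io i0.
have [a' [b' [n' [k' [ha' hb' zE' [rn rk] nk]]]]] := rep_ge i ii0.
rewrite zE' in Vi; have kn := proj1 (seq_valring_order ha' hb') Vi.
(* Membership of [z] in [V i] makes the denominator attain the minimum; by [step] it keeps order
   [r], which gives [z] in [V h] for every later [h]. *)
have k'r : k' = r by case: nk => // nr; apply/eqP; rewrite eqn_leq rk andbT -nr.
exists i => h ih.
have [a1 [b1 [n1 [h1 h2 zE1 rn1]]]] : exists a1 b1 n1,
    [/\ has_order (R h) a1 n1, has_order (R h) b1 r, z = a1 / b1 & (r <= n1)%N].
  rewrite -(subnK ih); elim: (h - i)%N => [|m [a1 [b1 [n1 [h1 h2 zE1 rn1]]]]].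
    by exists a', b', n'; rewrite -k'r.
  have [a2 [b2 [n2 [k2 [? h3 ? [? _] [_ k2r]]]]]] := step _ _ _ _ _ h1 h2 zE1 rn1 (leqnn r) (or_intror erefl).
  by exists a2, b2, n2; rewrite addSn; split=> //; rewrite -(k2r erefl).
by rewrite zE1; apply/(seq_valring_order h1 h2).
Qed.

(** * The boundary valuation ring as a limit of arbitrarily late order valuation rings *)

Variable U : F -> Prop.
Hypothesis bU : boundary_valuation_ring R U.

(** The definition of a limit point supplies one index; it is made large by excluding small ones. If
    [V i0] differs from [U] at [z], adding [z] to [G] or [z^-1] to [H] excludes [i0]; if they agree,
    the requirement that [V i] differ from [U] does. *)
Lemma boundary_large i0 (G H : seq F) :
  (forall g, g \in G -> U g) -> (forall g, g \in H -> valmax U g) ->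
  exists i, [/\ (i0 <= i)%N, exists z, ~ (V i z <-> U z),
    forall g, g \in G -> V i g & forall g, g \in H -> valmax (V i) g].
Proof.
case: (bU) => [[sU vU] [_ lim]].
elim: i0 G H => [|i0 IH] G H UG UH.
  by have [i [h1 [h2 h3]]] := lim G H UG UH; exists i.
case: (classic (exists z, ~ (V i0 z <-> U z))) => [[z nz]|eqV]; last first.
  have [i [ii0 ne hG hH]] := IH G H UG UH; exists i; split=> //.
  by rewrite ltn_neqAle ii0 andbT; apply: contra_not_neq eqV => ->.
case: (classic (U z)) => Uz.
  have nV : ~ V i0 z by move=> h; apply: nz.
  have [|i [ii0 ne hG hH]] := IH (z :: G) H _ UH.
    by move=> g; rewrite inE => /predU1P [->|/UG].
  exists i; split=> //; last by move=> g gG; apply: hG; rewrite inE gG orbT.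
  rewrite ltn_neqAle ii0 andbT; apply/eqP => e; apply: nV; rewrite e; apply: hG.
  by rewrite inE eqxx.
have Vz : V i0 z by apply: NNPP => h; apply: nz; split.
have z0 : z != 0 by apply/eqP => z0; apply: Uz; rewrite z0; apply: subring0.
have [|i [ii0 ne hG hH]] := IH G (z^-1 :: H) UG.
  move=> g; rewrite inE => /predU1P [->|/UH//].
  by split; [case: (vU z z0) | right; rewrite invrK].
exists i; split=> //; last by move=> g gH; apply: hH; rewrite inE gH orbT.
rewrite ltn_neqAle ii0 andbT; apply/eqP => e; rewrite e in Vz.
have [_ []] := hH z^-1 (mem_head _ _); last by rewrite invrK.
by move/eqP; rewrite invr_eq0 (negPf z0).
Qed.

(** For S inside [U]: if [z] in [R i] were not in [U], then [z^-1] would be in the maximal ideal of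
    [U], hence of some [V j] with [j >= i], although [z] is in [R j] and so in [V j]. *)
Theorem union_eq_boundary_hull z : (exists i, R i z) <->
  (U z /\ noetherian_hull (fun y => exists i, R i y) z).
Proof.
case: (bU) => [[sU vU] [R0U _]]; split=> [[i Rz]|[Uz Tz]].
  split; last by move=> W _ [SW _]; apply: SW; exists i.
  apply: NNPP => nUz.
  have z0 : z != 0 by apply/eqP => z0; apply: nUz; rewrite z0; apply: subring0.
  have [||j [ij _ _ hH]] := @boundary_large i [::] [:: z^-1] => //.
    move=> g; rewrite inE => /eqP ->.
    by split; [case: (vU z z0) | right; rewrite invrK].
  have [_ []] := hH z^-1 (mem_head _ _).
    by move/eqP; rewrite invr_eq0 (negPf z0).
  by rewrite invrK; apply; apply: seq_in_valring; apply: seq_sub ij Rz.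
have [->|z0] := eqVneq z 0; first by exists 0%N; apply: subring0.
have [|i Vz] := valring_eventually z0.
  move=> i0; have [||j [ij _ hG _]] := @boundary_large i0 [:: z] [::] => //.
    by move=> g; rewrite inE => /eqP ->.
  by exists j; split=> //; apply: hG; apply: mem_head.
have [j [k [ij Rj]]] := hull_sub_localization i Tz.
exact: valring_descent ij Vz Rj.
Qed.

End BlowupSequence.

Theorem theorem5p4 (F : fieldType) (R : nat -> F -> Prop) (V : F -> Prop) :
  quotient_field (R 0%N) ->
  (forall i, exists d, (2 <= d)%N /\ regular_local (R i) d) ->
  (forall i, quadratic_transform (R i) (R i.+1)) ->
  (forall i, ssub (R i) (R i.+1)) ->
  boundary_valuation_ring R V ->
  forall z : F, (exists i, R i z) <-> (V z /\ noetherian_hull (fun y => exists i, R i y) z).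
Proof.
move=> qR rR tR _ bV; have bl i : exists t, blowup (R i) (R i.+1) t.
  have [d [d2 rd]] := rR i; have [d1 [_ [_ [lR _]]]] := rR i.+1.
  exact: quadratic_transform_blowup (ltnW d2) rd lR (tR i).
pose t i := proj1_sig (constructive_indefinite_description _ (bl i)).
have tP i : blowup (R i) (R i.+1) (t i).
  exact: (proj2_sig (constructive_indefinite_description _ (bl i))).
exact: union_eq_boundary_hull tP qR _ bV.
Qed.
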